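(* Assume the following. (i) $f$ and $g$ are continuous. (ii) There are constants $\kappa>\frac12$, $C_\psi\ge 0$, $\alpha\ge 0$ such that for every $R\ge 0$ the function $\psi$ is Hölder on $I\times\{x\in E:|x|\le R\}$ with exponent $\kappa$ and a constant $K_R$, i.e. $|\psi(t,x)-\psi(s,y)|\le K_R(|t-s|^\kappa+|x-y|^\kappa)$ whenever $s,t\in I$, $|x|,|y|\le R$, and $K_R\le C_\psi(1+R^\alpha)$. (iii) $U$ is closed and convex. (iv) $\phi$ is continuous on $I\times E\times U$, convex in $u\in U$, and there are constants $C_\phi>0$, $\delta>0$, $r>1$ with $\phi(t,x,u)\ge C_\phi(|u|^r-|x|^\delta)$ for all $(t,x,u)\in I\times E\times U$. (v) $\xi\in E$ and there are nonnegative constants $C_s,C_e,\beta,\gamma$ such that for any control $u\in\mathcal U_r$ and any local solution $x$ of the state equation with control $u$ and initial condition $\xi$, $$\|\dot x\|_r\le C_s(1+\|u\|_r^\beta),\qquad \|x\|_\infty\le C_e(1+\|u\|_r^\gamma).$$ Further $\gamma(\alpha+\kappa-\frac12)+\frac\beta2<r$ and $\gamma\delta<r$. Then (feasible and admissible meaning with respect to $\xi$): (a) For any $u\in\mathcal U_r$ the state equation has a (not necessarily unique) solution $x$ on $I$ with $x(0)=\xi$. (b) If $(x,u)$ is feasible, the stochastic part $\int_I\psi(t,x(t))\,d\eta(t)$ of the cost functional is well defined and finite. (c) If $(x,u)$ is feasible, the function $t\mapsto\phi(t,x(t),u(t))$ is measurable and bounded below by an integrable function; hence the deterministic costs $\int_I\phi(t,x(t),u(t))\,dt$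 are well defined as an element of $\mathbb R\cup\{\infty\}$. (d) If $(x,u)$ is admissible, then $\|u\|_r<\infty$.
   Context: $T>0$, $I=[0,T]$; $E$ is a finite-dimensional real vector space with norm $|\cdot|$; $d\in\mathbb N$; $U\subset E$ is the control set; $f:I\times E\to E$, $g:I\times E\to L(E,E)$, $\phi:I\times E\times E\to\mathbb R$, $\psi:I\times E\to L(\mathbb R^d,\mathbb R)$ are given functions. The state equation is $\dot x(t)=f(t,x(t))+g(t,x(t))u(t)$. A process with respect to $\xi$ is a pair $(x,u)$ with $u:I\to E$ measurable, $x:I\to E$ absolutely continuous, $x(0)=\xi$, and the state equation satisfied for a.e. $t\in I$. It is feasible if $u(t)\in U$ for a.e. $t\in I$; a feasible process is admissible if it has finite costs $A(x,u)=\int_I\phi(t,x(t),u(t))\,dt+\int_I\psi(t,x(t))\,d\eta(t)$. A local solution is a solution of the state equation on a possibly smaller interval $[0,T_1]$, $T_1\le T$ (norms of $x,\dot x$ are then over $[0,T_1]$). $\|u\|_r=(\int_I|u(s)|^r ds)^{1/r}$, $\|u\|_\infty=\sup_{s\in I}|u(s)|$; $\mathcal U_r$ is the set of measurable $u:I\to E$ with $u(t)\in U$ a.e. and $\|u\|_r<\infty$. For $p\ge1$ the $p$-variation of a continuous function $x$ on $I$ is $[x]_p=(\sup\sum_i|x(t_{i+1})-x(t_i)|^p)^{1/p}$, the supremum being over finite dissections $0=t_0<\dots<t_n=T$. The Young integral $\int_I x\,dy$ is the limit of $\sum_i x(\tau_i)(y(t_{i+1})-y(t_i))$, $\tau_i\in[t_i,t_{i+1}]$,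 as the mesh of the dissections tends to $0$, required to exist independently of the choice of dissections and of the $\tau_i$. The observation path $\eta:I\to\mathbb R^d$ is a fixed continuous function with $[\eta]_p<\infty$ for every $p>2$; integrals against $\eta$ are Young integrals. *)

(* Defs.v *)
From HB Require Import structures.
From mathcomp Require Import all_boot all_order all_algebra.
From mathcomp Require Import all_classical all_reals all_analysis.

Set Implicit Arguments.
Unset Strict Implicit.
Unset Printing Implicit Defensive.
Import Order.TTheory GRing.Theory Num.Theory.
Import numFieldNormedType.Exports.

Local Open Scope classical_set_scope.
Local Open Scope ring_scope.

(** Finite-dimensional vector spaces with a norm. *)
#[short(type="normedVectType")]
HB.structure Definition NormedVector (K : numFieldType) :=
  {V of NormedModule K V & Vector K V}.

(** The line with the Lebesgue (not Borel) measurable sets.  Borel sets would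
    not do: a control is in [U] only almost everywhere and the running cost is
    continuous only over [U], so it need not be Borel along a process. *)
Notation lebesgueType R :=
  (caratheodory_type ((wlength (@idfun R))^*)%mu).

Section definitions.
Context {R : realType}.
Local Notation leb := (@completed_lebesgue_measure R).

(** [sup] is [0] on unbounded sets, which does not occur for linear maps on
    finite-dimensional spaces. *)
Definition op_norm (V W : normedModType R) (A : V -> W) : R :=
  sup [set `|A v| | v in [set v | `|v| <= 1]].

Definition lebesgue_measurable (V : normedModType R) (D : set R) (u : R -> V)
    : Prop :=
  @measurable_fun _ _ (lebesgueType R) (g_sigma_algebraType (@open V)) D u.

Definition Lr_norm (V : normedModType R) (r : R) (D : set R) (u : R -> V)
    : \bar R :=
  ((\int[leb]_(s in D) (`|u s| `^ r)%:E) `^ r^-1)%E.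

Definition sup_norm (V : normedModType R) (D : set R) (x : R -> V) : \bar R :=
  ereal_sup [set (`|x s|)%:E | s in D].

Definition absolutely_continuous (V : normedModType R) (a b : R) (x : R -> V)
    : Prop :=
  forall e, 0 < e -> exists2 d, 0 < d &
    forall (n : nat) (c c' : 'I_n -> R),
      (forall i, a <= c i /\ c i <= c' i /\ c' i <= b) ->
      (forall i j, i != j -> c' i <= c j \/ c' j <= c i) ->
      \sum_(i < n) (c' i - c i) < d ->
      \sum_(i < n) `|x (c' i) - x (c i)| < e.

(** A dissection [a = t_0 < ... < t_n = b] is encoded by [s = t_1, ..., t_n]. *)
Definition p_variation (V : normedModType R) (a b p : R) (x : R -> V)
    : \bar R :=
  ((ereal_sup [set (\sum_(0 <= i < size s)
        `|x (nth b (a :: s) i.+1) - x (nth b (a :: s) i)| `^ p)%:E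
      | s in itv_partition a b]) `^ p^-1)%E.

Definition is_young_integral (d : nat) (a b : R)
    (F : R -> 'Hom('rV[R]_d, R^o)) (eta : R -> 'rV[R]_d) (l : R) : Prop :=
  forall e, 0 < e -> exists2 h, 0 < h &
    forall (s : seq R) (tau : nat -> R), itv_partition a b s ->
      let t := nth b (a :: s) in
      (forall i, (i < size s)%N ->
        t i.+1 - t i < h /\ t i <= tau i <= t i.+1) ->
      `|\sum_(0 <= i < size s) F (tau i) (eta (t i.+1) - eta (t i)) - l| < e.

Section control.
Variables (E : normedVectType R) (U : set E) (f : R -> E -> E)
  (g : R -> E -> 'End(E)).

(** [x] solves the state equation with control [u] on [[0, T]].  The derivative
    at the end points is irrelevant since these form a null set. *)
Definition solution (T : R) (xi : E) (x u : R -> E) : Prop :=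
  [/\ absolutely_continuous 0 T x, x 0 = xi &
      {ae leb, forall t : R, t \in `[0, T] ->
        is_derive t (1 : R) x (f t (x t) + g t (x t) (u t))}].

Definition process (T : R) (xi : E) (x u : R -> E) : Prop :=
  lebesgue_measurable `[0, T] u /\ solution T xi x u.

Definition takes_values_in_U (T : R) (u : R -> E) : Prop :=
  {ae leb, forall t : R, t \in `[0, T] -> U (u t)}.

Definition feasible (T : R) (xi : E) (x u : R -> E) : Prop :=
  process T xi x u /\ takes_values_in_U T u.

Definition controls (T r : R) : set (R -> E) :=
  [set u | [/\ lebesgue_measurable `[0, T] u, takes_values_in_U T u &
               (Lr_norm r `[0%R, T] u < +oo)%E]].

Variables (phi : R -> E -> E -> R) (d : nat)
  (psi : R -> E -> 'Hom('rV[R]_d, R^o)) (eta : R -> 'rV[R]_d).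

Definition deterministic_cost (T : R) (x u : R -> E) : \bar R :=
  (\int[leb]_(t in `[0%R, T]) (phi t (x t) (u t))%:E)%E.

Definition admissible (T : R) (xi : E) (x u : R -> E) : Prop :=
  feasible T xi x u /\
  exists2 S : R, is_young_integral 0 T (fun t => psi t (x t)) eta S &
    (deterministic_cost T x u + S%:E)%E \is a fin_num.

End control.
End definitions.

(* Main.v *)
(** (a) Freeze the coefficients on uniform grids: with [V] a primitive of [u],
    the Euler polygons have increments [f dt + g dV].  Their limit along an
    ultrafilter satisfies
    [|x t - x s - f(s, x s)(t - s) - g(s, x s)(V t - V s)|
       <= e ((t - s) + (W t - W s))] as soon as [t - s] is small, where [W] is a
    primitive of a weighted sum of the [|u_i|], the [u_i] being the coordinates
    of [u]; differentiating at the points where [V' = u] and [W'] exists gives the state equation, and no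
    integral of the nonlinear terms is ever taken.  The fields are first
    composed with a radial retraction; a solution leaving the ball would
    contradict the a priori bound at its first exit time.

    (b) [x] has finite variation, so [t |-> psi t (x t)] has increments
    [o((m t - m s) ^ k)] with [k > 1/2], and those of [eta] are at most
    [(m t - m s) ^ (1/p)] with [k + 1/p > 1], for one nondecreasing [m].  This
    is Young's condition; the estimate for Riemann sums is proved by cutting
    where [m] has been halved, which needs no continuity of [m].

    (c), (d) [phi] is continuous on a closed set and [x] is bounded, so the
    growth condition bounds [phi] below and [|u| ^ r] above. *)
Require Import Defs.
From HB Require Import structures.
From mathcomp Require Import all_boot all_order all_algebra.
From mathcomp Require Import all_classical all_reals all_analysis.
From mathcomp Require Import measurable_realfun ring lra.
Set Implicit Arguments.
Unset Strict Implicit.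
Unset Printing Implicit Defensive.
Import Order.TTheory GRing.Theory Num.Theory.
Import numFieldNormedType.Exports.
Local Open Scope classical_set_scope.
Local Open Scope ring_scope.

(** * Finite-dimensional spaces and ultralimits *)

Section finite_dimension.
Context {R : realType}.

(** Controls are merely integrable, so Peano's theorem does not apply as it stands: the Euler scheme
    is driven by the path [(t, V t)], whose increments are dominated by those of a real function
    [w], and [w] replaces time in the estimates. A limit along an ultrafilter exists at all times at
    once, so no subsequence has to be extracted. Uniform grids and an ultrafilter serve the Young
    integral too: its value is the ultralimit of the left sums on the grids, and every fine tagged
    sum is compared with it. Partition points are rounded down to a grid; as the control [m] may
    jump, the continuity of [eta] is what makes the rounding harmless. The exponent [kappa] is
    lowered a little, and the gap turns Hölder constants into factors that vanish with the mesh.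
    Primitives are differentiated on the Borel side, so Lebesgue measurable functions are first
    modified on a null set. The running cost cannot be treated so, since nothing is known of it
    where the control leaves [U]; there completeness of the measure is used. *)

Lemma rV_coord_le (n : nat) (v : 'rV[R]_n) i : `|v 0 i| <= `|v|.
Proof.
rewrite [leRHS]/Num.norm /= mx_normrE; apply/bigmax_geP; right => /=.
by exists (0, i).
Qed.

Lemma rV_linear_bounded (n : nat) (W : normedModType R)
    (A : {linear 'rV[R]_n -> W}) :
  exists2 C, 0 <= C & forall v, `|A v| <= C * `|v|.
Proof.
exists (\sum_(i < n) `|A (delta_mx 0 i)|); first exact: sumr_ge0.
move=> v; rewrite {1}(row_sum_delta v) linear_sum mulr_suml.
apply: (le_trans (ler_norm_sum _ _ _)); apply: ler_sum => i _.
by rewrite linearZ normrZ mulrC ler_wpM2l// rV_coord_le.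
Qed.

Lemma norm_bounded_linear_continuous (V W : normedModType R)
    (A : {linear V -> W}) C :
  (forall v, `|A v| <= C * `|v|) -> continuous A.
Proof.
move=> AC; apply: bounded_linear_continuous; apply/linear_boundedP.
near=> M => v; apply: le_trans (AC v) _.
apply: ler_wpM2r; first exact: normr_ge0.
by near: M; apply: nbhs_pinfty_ge; rewrite num_real.
Unshelve. all: by end_near. Qed.

(** Some bound [C] is required for the set of values to be bounded, as [sup] would otherwise return
    its default value; then [v] is scaled to norm 1. *)
Lemma op_norm_ge (V W : normedModType R) (A : {linear V -> W}) C v :
  (forall v, `|A v| <= C * `|v|) -> `|A v| <= op_norm A * `|v|.
Proof.
move=> AC.
have ub : has_ubound [set `|A v| | v in [set v | `|v| <= 1]].
  exists `|C| => _ [w /= w1 <-]; apply: le_trans (AC w) _.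
  rewrite -[leRHS]mulr1; apply: le_trans (ler_wpM2l (normr_ge0 C) w1).
  by apply: ler_wpM2r => //; exact: ler_norm.
have [->|v0] := eqVneq v 0; first by rewrite linear0 !normr0 mulr0.
have vp : 0 < `|v| by rewrite normr_gt0.
rewrite -ler_pdivrMr//; have -> : `|A v| / `|v| = `|A (`|v|^-1 *: v)|.
  by rewrite linearZ normrZ normfV normr_id mulrC.
apply: ub_le_sup => //; exists (`|v|^-1 *: v) => //=.
by rewrite normrZ normfV normr_id mulVf// gt_eqF.
Qed.

Section coordinates.
Variable E : normedVectType R.
Notation n := (\dim {:E}).
Notation b := (vbasis {:E}).

Lemma coord_expand (x : E) : x = \sum_(i < n) coord b i x *: b`_i.
Proof. exact: (coord_vbasis (memvf x)). Qed.

(** The coordinate isomorphism. The norm of [E] is not tied to a basis, so compactness and bounds on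
    linear maps are carried over from row vectors once this map is known to be bounded in both
    directions. *)
Definition of_row (w : 'rV[R]_n) : E := \sum_(i < n) w 0 i *: b`_i.

Fact of_row_is_linear : linear of_row.
Proof.
move=> a u v; rewrite /of_row scaler_sumr -big_split /=.
by apply: eq_bigr => i _; rewrite !mxE scalerDl scalerA.
Qed.
HB.instance Definition _ :=
  GRing.isLinear.Build R 'rV[R]_n E *:%R of_row of_row_is_linear.

Lemma coord_of_row w i : coord b i (of_row w) = w 0 i.
Proof. by apply: coord_sum_free; exact: basis_free (vbasisP _). Qed.

Lemma of_rowK x : of_row (\row_i coord b i x) = x.
Proof.
by rewrite [RHS]coord_expand; apply: eq_bigr => i _; rewrite mxE.
Qed.

Lemma of_row_inj w : of_row w = 0 -> w = 0.
Proof.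
by move=> w0; apply/rowP => i; rewrite mxE -coord_of_row w0 linear0.
Qed.

Lemma of_row_continuous : continuous of_row.
Proof.
have [C _] := rV_linear_bounded of_row.
exact: norm_bounded_linear_continuous.
Qed.

(* The norm attains a positive minimum on the image of the unit sphere. *)
Lemma of_row_lower_bound : exists2 m, 0 < m & forall w, m * `|w| <= `|of_row w|.
Proof.
pose S := [set w : 'rV[R]_n | `|w| = 1].
have cS : compact S.
  apply: bounded_closed_compact.
    by exists 1; split; [exact: num_real|move=> M M1 w /= ->; exact: ltW].
  apply: (@closed_comp _ _ (fun w : 'rV[R]_n => `|w|) [set 1]).
    by move=> w _; exact: norm_continuous.
  exact: closed_eq.
pose f := fun w => `|of_row w|.
have cf : continuous f.
  move=> w; apply: (@continuous_comp _ _ _ of_row (fun x : E => `|x|)).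
    exact: of_row_continuous.
  exact: norm_continuous.
have cfS : compact (f @` S).
  by apply: continuous_compact => //; exact: continuous_subspaceT.
have : ~ (f @` S) 0.
  move=> [w /= w1 /eqP]; rewrite normr_eq0 => /eqP/of_row_inj w0.
  by move: w1; rewrite /S /= w0 normr0 => /esym/eqP; rewrite oner_eq0.
(* A ball around 0 in this open set gives [m]. This covers dimension 0 too, where the sphere is
   empty and no minimum is attained. *)
have : open (~` (f @` S)).
  by rewrite openC; apply: compact_closed => //; exact: Rhausdorff.
rewrite openE => oS /oS /nbhs_ballP [m /= m0 mS].
exists m => // w; have [->|w0] := eqVneq w 0.
  by rewrite normr0 mulr0.
have wp : 0 < `|w| by rewrite normr_gt0.
rewrite -ler_pdivlMr// leNgt; apply/negP => fm.
apply: (mS (f (`|w|^-1 *: w))); last first.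
  exists (`|w|^-1 *: w) => //; rewrite /S /= normrZ normfV normr_id mulVf//.
  by rewrite gt_eqF.
rewrite /ball /= sub0r normrN /f linearZ normr_id normrZ normfV normr_id.
by rewrite mulrC.
Qed.

Lemma coord_bounded :
  exists2 C, 0 < C & forall (x : E) i, `|coord b i x| <= C * `|x|.
Proof.
have [m m0 mb] := of_row_lower_bound; exists m^-1; first by rewrite invr_gt0.
move=> x i; rewrite -ler_pdivrMl ?invr_gt0// invrK.
have := mb (\row_i coord b i x); rewrite of_rowK; apply: le_trans.
rewrite ler_pM2l//; apply: le_trans (rV_coord_le _ i).
by rewrite mxE.
Qed.

Lemma linear_bounded_finite (W : normedModType R) (A : {linear E -> W}) :
  exists2 C, 0 <= C & forall v, `|A v| <= C * `|v|.
Proof.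
have [C C0 CE] := coord_bounded.
exists (\sum_(i < n) C * `|A b`_i|).
  by apply: sumr_ge0 => i _; rewrite mulr_ge0// ltW.
move=> v; rewrite {1}(coord_expand v) linear_sum mulr_suml.
apply: (le_trans (ler_norm_sum _ _ _)); apply: ler_sum => i _.
by rewrite linearZ normrZ mulrAC ler_wpM2r.
Qed.

(** The preimage of the ball under [of_row] is closed, and bounded by [of_row_lower_bound], hence
    compact. *)
Lemma closed_norm_ball_compact (M : R) : compact [set x : E | `|x| <= M].
Proof.
rewrite (_ : mkset _ = of_row @` [set w | `|of_row w| <= M]); last first.
  rewrite eqEsubset; split => [x /= xM|_ [w /= wM <-]//].
  by exists (\row_i coord b i x); rewrite /= of_rowK.
apply: continuous_compact.
  by apply: continuous_subspaceT; exact: of_row_continuous.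
apply: bounded_closed_compact.
  have [m m0 mb] := of_row_lower_bound.
  exists (M / m); split; first exact: num_real.
  move=> N MN w /= wM; apply: le_trans (ltW MN).
  by rewrite ler_pdivlMr// mulrC (le_trans (mb w)).
apply: (@closed_comp _ _ (fun w => `|of_row w|) [set y | y <= M]).
  move=> w _; apply: (@continuous_comp _ _ _ of_row (fun x : E => `|x|)).
    exact: of_row_continuous.
  exact: norm_continuous.
exact: closed_le.
Qed.

Lemma rational_coordinates_dense (x : E) e : 0 < e ->
  exists q : {ffun 'I_n -> rat},
    `|x - \sum_(i < n) ratr (q i) *: b`_i| < e.
Proof.
(* The summand 1 keeps [B] positive in dimension 0 and makes the final inequality strict. *)
move=> e0; pose B := 1 + \sum_(i < n) `|b`_i|.
have B0 : 0 < B by rewrite ltr_pwDl// sumr_ge0.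
have dB : 0 < e / B by rewrite divr_gt0.
have ex i : exists q : rat, `|coord b i x - ratr q| < e / B.
  have [|q] := @rat_in_itvoo R (coord b i x - e / B) (coord b i x).
    by rewrite ltrBlDr ltrDl.
  rewrite in_itv /= => /andP[q1 q2]; exists q.
  by rewrite ger0_norm ?subr_ge0 1?ltW// ltrBlDr -ltrBlDl.
exists [ffun i => projT1 (cid (ex i))].
set y := \sum_(_ < _) _.
have -> : x - y = \sum_(i < n)
    (coord b i x - ratr (projT1 (cid (ex i)))) *: b`_i.
  rewrite {1}(coord_expand x) /y -sumrB; apply: eq_bigr => i _.
  by rewrite ffunE scalerBl.
apply: (@le_lt_trans _ _ (\sum_(i < n) e / B * `|b`_i|)).
  apply: (le_trans (ler_norm_sum _ _ _)); apply: ler_sum => i _.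
  by rewrite normrZ ler_wpM2r// ltW//; case: cid.
rewrite -mulr_sumr mulrAC ltr_pdivrMr// ltr_pM2l//.
by rewrite /B ltrDr.
Qed.

End coordinates.
End finite_dimension.

(** Refining [\oo] means that eventual properties hold along [G], so limits along it extend ordinary
    ones. *)
Lemma ultrafilter_nat : exists G : set_system nat, UltraFilter G /\ \oo `<=` G.
Proof. exact: ultraFilterLemma. Qed.

(** A cluster point of an ultrafilter is its limit: if a neighbourhood were not in the filter, its
    complement would be, and would have to meet it. *)
Lemma ultra_compact_cvg (T : topologicalType) (A : set T)
    (G : set_system nat) (u : nat -> T) :
  UltraFilter G -> compact A -> G (u @^-1` A) ->
  exists2 p, A p & u @ G --> p.
Proof.
move=> UG cA uA.
have PG : ProperFilter (u @ G) by exact: fmap_proper_filter.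
have [p [Ap clp]] := cA (u @ G) PG uA.
exists p => // B pB.
have [//|nB] := in_ultra_setVsetC (u @^-1` B) UG.
by have [z [nz Bz]] := clp (~` B) B nB pB.
Qed.

Section ultralimits.
Context {R : realType}.
Variable G : set_system nat.
Hypotheses (UG : UltraFilter G) (Goo : \oo `<=` G).

Lemma ultra_dist_lt (V : normedModType R) (u : nat -> V) (p : V) e :
  u @ G --> p -> 0 < e -> G [set n | `|u n - p| < e].
Proof.
move=> /cvgrPdist_lt up /up; apply: filterS => n /=.
by rewrite distrC.
Qed.

Lemma ultra_inv_lt (c e : R) : 0 < e -> G [set n | c / n.+1%:R < e].
Proof.
move=> e0; apply: Goo; near=> n; rewrite /= ltr_pdivrMr// -ltr_pdivrMl//.
apply: (@lt_le_trans _ _ n%:R); last by rewrite ler_nat.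
by near: n; exact: nbhs_infty_gtr.
Unshelve. all: by end_near. Qed.

End ultralimits.

(** * Uniform continuity and boundedness on compact sets *)

Section compact_pseudometric.
Context {R : realType} (V : normedModType R) (D : set V) (P : V -> V -> R).
Hypotheses (cD : compact D) (P_sym : forall x y, P x y = P y x)
  (P_tri : forall x y z, D x -> D y -> D z -> P x z <= P x y + P y z)
  (P_cont : forall z, D z -> forall e, 0 < e -> exists2 h, 0 < h &
    forall x, D x -> `|x - z| < h -> P x z < e).

(** Heine-Cantor with a pseudometric [P] in place of the distance of values, so that one argument
    serves [f], the maps [g] compared by [op_norm], and [eta]. Bad pairs at distance tending to 0
    would have a common ultralimit [z], near which [P] is small. *)
Lemma compact_pseudometric_uniform e : 0 < e -> exists2 h, 0 < h &
  forall x y, D x -> D y -> `|x - y| < h -> P x y < e.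
Proof.
move=> e0; apply: contrapT => H.
have bad n : exists p : V * V, [/\ D p.1, D p.2, `|p.1 - p.2| < 1 / n.+1%:R &
    e <= P p.1 p.2].
  apply: contrapT => H1; apply: H; exists (1 / n.+1%:R); first by rewrite divr_gt0.
  move=> x y Dx Dy xy; rewrite ltNge; apply/negP => eP; apply: H1.
  by exists (x, y).
have [p pP] := choice bad.
have [G [UG Goo]] := ultrafilter_nat.
have [z Dz pz] : exists2 z, D z & (fun n => (p n).1) @ G --> z.
  by apply: (ultra_compact_cvg UG cD); apply: filterE => n; have [] := pP n.
have [h h0 Ph] := P_cont Dz (divr_gt0 e0 (ltr0n _ 2)).
have hh : 0 < h / 2 by rewrite divr_gt0.
have [n [/= n1 n2]] : exists n, (`|(p n).1 - z| < h / 2 /\ 1 / n.+1%:R < h / 2).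
  apply: (@filter_ex _ G); apply: filterI.
    exact: ultra_dist_lt.
  exact: ultra_inv_lt.
have [D1 D2 p12 eP] := pP n.
have h1 : P (p n).1 z < e / 2.
  by apply: Ph => //; apply: lt_trans n1 _; rewrite ltr_pdivrMr// ltr_pMr// ltr1n.
have h2 : P (p n).2 z < e / 2.
  apply: Ph => //; rewrite -(subrK (p n).1 (p n).2) -addrA.
  apply: le_lt_trans (ler_normD _ _) _; rewrite (splitr h) ltrD//.
  by rewrite distrC; exact: lt_trans n2.
have := P_tri D1 Dz D2; rewrite (P_sym z) => h3.
by move: (le_lt_trans h3 (ltrD h1 h2)); rewrite -splitr ltNge eP.
Qed.

Lemma compact_pseudometric_bounded z0 : D z0 ->
  exists2 M, 0 <= M & forall x, D x -> P x z0 <= M.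
Proof.
move=> D0; apply: contrapT => H.
have bad n : exists2 x, D x & n%:R < P x z0.
  apply: contrapT => H1; apply: H; exists n%:R => // x Dx.
  by rewrite leNgt; apply/negP => ?; apply: H1; exists x.
have /choice[p pP] : forall n, exists x, D x /\ n%:R < P x z0.
  by move=> n; have [x ? ?] := bad n; exists x.
have [G [UG Goo]] := ultrafilter_nat.
have [z Dz pz] : exists2 z, D z & p @ G --> z.
  by apply: (ultra_compact_cvg UG cD); apply: filterE => n; have [] := pP n.
have [h h0 Ph] := P_cont Dz ltr01.
have [n [/= n1 n2]] : exists n, (`|p n - z| < h /\ 1 + P z z0 < n%:R).
  apply: (@filter_ex _ G); apply: filterI; first exact: ultra_dist_lt.
  by apply: Goo; exact: nbhs_infty_gtr.
have [Dp nP] := pP n.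
have := P_tri Dp Dz D0; rewrite leNgt => /negP; apply.
by apply: lt_trans nP; apply: lt_trans n2; rewrite ltrD2r Ph.
Qed.

End compact_pseudometric.

(** * Equations driven by a path of bounded variation *)

Section uniform_grid.
Context {R : realType} (T : R).
Hypothesis T_gt0 : 0 < T.

(** There are [n.+1] cells, so that the mesh is defined for every [n]. For [0 <= t],
    [grid_floor n t] is the index of the last node not after [t]; at [T] it is [n.+1], so rounding
    fixes both end points. *)
Definition grid (n k : nat) : R := k%:R * (T / n.+1%:R).
Definition grid_floor (n : nat) (t : R) : nat := Num.truncn (t / (T / n.+1%:R)).

Let step_gt0 n : 0 < T / n.+1%:R. Proof. by rewrite divr_gt0. Qed.

Lemma grid0 n : grid n 0 = 0. Proof. by rewrite /grid mul0r. Qed.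

Lemma grid_last n : grid n n.+1 = T.
Proof. by rewrite /grid mulrC divfK. Qed.

Lemma ler_grid n k l : (k <= l)%N -> grid n k <= grid n l.
Proof. by move=> kl; rewrite /grid ler_pM2r// ler_nat. Qed.

Lemma gridS n k : grid n k.+1 = grid n k + T / n.+1%:R.
Proof. by rewrite /grid -natr1 mulrDl mul1r. Qed.

Lemma grid_itv n k : (k <= n.+1)%N -> 0 <= grid n k <= T.
Proof.
by move=> kn; rewrite -[X in _ <= _ <= X](grid_last n) -{1}(grid0 n) !ler_grid.
Qed.

Lemma grid_floor0 n : grid_floor n 0 = 0%N.
Proof. by rewrite /grid_floor mul0r truncn0. Qed.

Lemma grid_floor_last n : grid_floor n T = n.+1.
Proof.
by rewrite /grid_floor invfM mulrA divff ?gt_eqF// mul1r invrK natrK.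
Qed.

Lemma grid_floor_le n t : 0 <= t -> grid n (grid_floor n t) <= t.
Proof.
by move=> t0; rewrite /grid -ler_pdivlMr// truncn_le divr_ge0// ltW.
Qed.

Lemma grid_floor_gt n t : t < grid n (grid_floor n t) + T / n.+1%:R.
Proof. by rewrite -gridS /grid -ltr_pdivrMr// truncnS_gt. Qed.

Lemma grid_floor_dist n t : 0 <= t ->
  `|grid n (grid_floor n t) - t| < T / n.+1%:R + T / n.+1%:R.
Proof.
move=> t0; rewrite distrC ger0_norm ?subr_ge0 ?grid_floor_le//.
rewrite ltrBlDl; apply: lt_le_trans (grid_floor_gt n t) _.
by rewrite lerD2l lerDl ltW.
Qed.

Lemma le_grid_floor n s t : s <= t -> (grid_floor n s <= grid_floor n t)%N.
Proof. by move=> st; rewrite le_truncn// ler_pM2r// invr_gt0. Qed.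

Lemma grid_floor_bound n t : t <= T -> (grid_floor n t <= n.+1)%N.
Proof. by move=> tT; rewrite -[leqRHS](grid_floor_last n) le_grid_floor. Qed.

Lemma ultra_grid_floor G t e : UltraFilter G -> \oo `<=` G -> 0 <= t ->
  0 < e -> G [set n | `|grid n (grid_floor n t) - t| < e].
Proof.
move=> UG Goo t0 e0.
apply: filterS (ultra_inv_lt Goo (T + T) e0) => n /= ne.
by apply: lt_trans ne; rewrite mulrDl; exact: grid_floor_dist.
Qed.

End uniform_grid.

Section controlled_equation.
Context {R : realType} (E : normedVectType R) (Y : normedModType R).
Variables (T M : R) (xi : E) (a : R -> E -> Y -> E) (Z : R -> Y) (w : R -> R).
Hypotheses (T_gt0 : 0 < T) (M_ge0 : 0 <= M)
  (a_add : forall t x, {morph a t x : y z / y + z})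
  (a_bound : forall t x y, 0 <= t <= T -> `|a t x y| <= M * `|y|)
  (a_unif : forall e, 0 < e -> exists2 h, 0 < h & forall s t x x',
     0 <= s <= T -> 0 <= t <= T -> `|s - t| < h -> `|x - x'| < h ->
     forall y, `|a s x y - a t x' y| <= e * `|y|)
  (Z_var : forall s t, 0 <= s -> s <= t -> t <= T -> `|Z t - Z s| <= w t - w s)
  (w_unif : forall e, 0 < e -> exists2 h, 0 < h & forall s t,
     0 <= s <= T -> 0 <= t <= T -> `|s - t| < h -> `|w s - w t| < e).

(** Node values of the Euler polygon for [dx = a(t, x) dZ]. *)
Fixpoint euler (t : nat -> R) (k : nat) : E :=
  if k is l.+1 then
    euler t l + a (t l) (euler t l) (Z (t l.+1) - Z (t l))
  else xi.

Lemma euler_increment (t : nat -> R) (A : Y -> E) e i j :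
  (forall k, (k < j)%N -> [/\ 0 <= t k, t k <= t k.+1 & t k.+1 <= T]) ->
  {morph A : y z / y + z} -> 0 <= e -> (i <= j)%N ->
  (forall l y, (i <= l < j)%N -> `|a (t l) (euler t l) y - A y| <= e * `|y|) ->
  `|euler t j - euler t i - A (Z (t j) - Z (t i))| <= e * (w (t j) - w (t i)).
Proof.
move=> + A_add e0; elim: j => [|j IH] tT ij aA.
  have -> : i = 0%N by apply/eqP; rewrite -leqn0.
  have /eqP : A 0 + A 0 = A 0 + 0 by rewrite -A_add !addr0.
  by rewrite (inj_eq (addrI _)) => /eqP A0; rewrite !subrr A0 subrr normr0 mulr0.
move: ij; rewrite leq_eqVlt => /predU1P[->|].
  have /eqP : A 0 + A 0 = A 0 + 0 by rewrite -A_add !addr0.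
  by rewrite (inj_eq (addrI _)) => /eqP A0; rewrite !subrr A0 subrr normr0 mulr0.
rewrite ltnS => ij.
have [tj0 tjj tjT] := tT j (ltnSn j).
have {}IH : `|euler t j - euler t i - A (Z (t j) - Z (t i))| <=
    e * (w (t j) - w (t i)).
  apply: IH => // [k kj|l y /andP[il lj]]; first by apply: tT; exact: ltnW.
  by apply: aA; rewrite il ltnW.
rewrite [X in A X](_ : _ = (Z (t j.+1) - Z (t j)) + (Z (t j) - Z (t i))); last first.
  by rewrite addrA subrK.
rewrite A_add /=.
rewrite (_ : _ - _ = (a (t j) (euler t j) (Z (t j.+1) - Z (t j))
    - A (Z (t j.+1) - Z (t j)))
    + (euler t j - euler t i - A (Z (t j) - Z (t i)))); last first.
  rewrite opprD !addrA; congr (_ - _).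
  rewrite -!addrA addrC -!addrA; congr (_ + _).
  by rewrite addrC -!addrA addrCA.
apply: le_trans (ler_normD _ _) _.
apply: (@le_trans _ _ (e * (w (t j.+1) - w (t j)) + e * (w (t j) - w (t i)))).
  apply: lerD => //; apply: le_trans (aA _ _ _) _; first by rewrite ij /=.
  by apply: ler_wpM2l => //; exact: Z_var.
by rewrite -mulrDr ler_wpM2l// addrA subrK.
Qed.

Let X n := euler (grid T n).

Let grid_step n k : (k < n.+1)%N ->
  [/\ 0 <= grid T n k, grid T n k <= grid T n k.+1 & grid T n k.+1 <= T].
Proof.
move=> kn; have /andP[-> _] := grid_itv T_gt0 (ltnW kn).
by have /andP[_ ->] := grid_itv T_gt0 kn; rewrite ler_grid.
Qed.

Let X_lip n i j : (i <= j <= n.+1)%N ->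
  `|X n j - X n i| <= M * (w (grid T n j) - w (grid T n i)).
Proof.
move=> /andP[ij jn].
rewrite -[X in `|X|](subr0 (X n j - X n i)).
apply: (@euler_increment _ (fun=> 0)) => // [k kj|y z|l y /andP[il lj]].
- by apply: grid_step; exact: leq_trans jn.
- by rewrite addr0.
- by rewrite subr0 a_bound// grid_itv// ltnW// (leq_trans lj).
Qed.

Let w_nd s t : 0 <= s -> s <= t -> t <= T -> w s <= w t.
Proof.
by move=> s0 st tT; rewrite -subr_ge0; apply: le_trans (Z_var s0 st tT).
Qed.

Let X_bound n k : (k <= n.+1)%N -> `|X n k| <= `|xi| + M * (w T - w 0).
Proof.
move=> kn; rewrite -(subrK xi (X n k)) addrC.
apply: le_trans (ler_normD _ _) _; rewrite lerD2l.
apply: le_trans (X_lip (i := 0%N) _) _; first by rewrite leq0n.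
rewrite grid0 ler_wpM2l// lerD2r//; have /andP[? ?] := grid_itv T_gt0 kn.
exact: w_nd.
Qed.

(* Both the Lipschitz bound and the local expansion pass to the ultralimit
   from [euler_increment]; there the comparison operator [A] is [0] for the
   former and [a u (x u)] for the latter. *)
Lemma controlled_equation_solvable : exists x : R -> E,
  [/\ x 0 = xi,
      forall s t, 0 <= s -> s <= t -> t <= T ->
        `|x t - x s| <= M * (w t - w s) &
      forall e, 0 < e -> exists2 h, 0 < h & forall s t u,
        0 <= s -> s <= u -> u <= t -> t <= T -> t - s < h ->
        `|x t - x s - a u (x u) (Z t - Z s)| <= e * (w t - w s)].
Proof.
have [G [UG Goo]] := ultrafilter_nat.
(* The range condition stands under the quantifier so that [choice] gives a total function,
   arbitrary outside the interval. *)
have lim t : exists p : E, 0 <= t <= T ->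
    (fun n => X n (grid_floor T n t)) @ G --> p.
  have [tT|] := boolP (0 <= t <= T); last by exists 0.
  have [p _ Xp] := ultra_compact_cvg UG
    (closed_norm_ball_compact (E := E) (M := `|xi| + M * (w T - w 0)))
    (filterE _ (fun n => X_bound (grid_floor_bound T_gt0 n (proj2 (andP tT))))).
  by exists p.
have [x xP] := choice lim.
have near_x t e : 0 <= t <= T -> 0 < e ->
    G [set n | `|X n (grid_floor T n t) - x t| < e].
  by move=> tT e0; apply: ultra_dist_lt => //; exact: xP.
have near_w t e : 0 <= t <= T -> 0 < e ->
    G [set n | `|w (grid T n (grid_floor T n t)) - w t| < e].
  move=> tT e0; have [h h0 wh] := w_unif e0.
  have /andP[t0 t1] := tT.
  apply: filterS (ultra_grid_floor T_gt0 UG Goo t0 h0) => n /= nh.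
  by apply: wh => //; apply: grid_itv => //; exact: grid_floor_bound.
have Z_dist s t : 0 <= s <= T -> 0 <= t <= T -> `|Z s - Z t| <= `|w s - w t|.
  move=> /andP[s0 sT] /andP[t0 tT]; have [st|/ltW ts] := leP s t.
    by rewrite distrC (distrC (w s)) (le_trans (Z_var s0 st tT))// ler_norm.
  by rewrite (le_trans (Z_var t0 ts sT))// ler_norm.
have floor_itv n t : 0 <= t <= T -> 0 <= grid T n (grid_floor T n t) <= T.
  by move=> /andP[? ?]; apply: grid_itv => //; exact: grid_floor_bound.
(* Estimates at the nodes below [s] and [t] pass to the limit, provided that they hold along [G]
   with arbitrarily small slack. *)
have limit_ineq (A : Y -> E) (c : R) s t : {morph A : y z / y + z} ->
    (forall y, `|A y| <= M * `|y|) -> 0 <= c ->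
    0 <= s <= T -> 0 <= t <= T ->
    (forall e, 0 < e -> G [set n | 
      `|X n (grid_floor T n t) - X n (grid_floor T n s)
        - A (Z (grid T n (grid_floor T n t)) - Z (grid T n (grid_floor T n s)))|
      <= c * (w (grid T n (grid_floor T n t)) - w (grid T n (grid_floor T n s)))
         + e]) ->
    `|x t - x s - A (Z t - Z s)| <= c * (w t - w s).
  move=> A_add A_bd c0 sT tT H; apply/ler_addgt0Pr => e e0.
  (* [B] counts the errors in units of [e / B]: 3 for the slack in [H] and the two values of [x],
     [M] for each end of the increment of [Z] under [A], [c] for each value of [w]. *)
  pose B := 3 + M + M + c + c.
  have B0 : 0 < B.
    by rewrite /B -!addrA ltr_pwDl// !addr_ge0.
  have d0 : 0 < e / B by rewrite divr_gt0.
  have [n [/= nH [/= n1 [/= n2 [/= n3 n4]]]]] := filter_ex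
    (filterI (H _ d0) (filterI (near_x _ _ tT d0) (filterI (near_x _ _ sT d0)
     (filterI (near_w _ _ tT d0) (near_w _ _ sT d0))))).
  set t' := grid _ _ (grid_floor T n t) in nH n3.
  set s' := grid _ _ (grid_floor T n s) in nH n4.
  have AB y z : A (y - z) = A y - A z.
    by apply/eqP; rewrite eq_sym subr_eq -A_add subrK.
  have -> : x t - x s - A (Z t - Z s) =
     (X n (grid_floor T n t) - X n (grid_floor T n s) - A (Z t' - Z s'))
     + ((x t - X n (grid_floor T n t)) + (X n (grid_floor T n s) - x s)
     + (A (Z t' - Z t) + A (Z s - Z s'))).
    rewrite !AB addrACA; congr (_ + _).
      by rewrite addrCA [X in _ = _ + X]addrA subrK addrA subrK.
    by rewrite !opprB [RHS]addrA [X in _ = X + _]addrA subrK [RHS]addrC addrA subrK.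
  have hZ u v : 0 <= u <= T -> 0 <= v <= T -> `|w u - w v| < e / B ->
      `|A (Z u - Z v)| <= M * (e / B).
    move=> uT vT uv; apply: le_trans (A_bd _) _; rewrite ler_wpM2l//.
    by apply: le_trans (Z_dist _ _ uT vT) _; exact: ltW.
  have h1 : `|A (Z t' - Z t)| <= M * (e / B) by apply: hZ => //; exact: floor_itv.
  have h2 : `|A (Z s - Z s')| <= M * (e / B).
    by apply: hZ => //; [exact: floor_itv|rewrite distrC].
  have h3 : c * (w t' - w s') <= c * (w t - w s) + c * (e / B) + c * (e / B).
    rewrite -!mulrDr ler_wpM2l//.
    move: n3 n4; rewrite !ltr_norml => /andP[_ ?] /andP[? _]; lra.
  apply: (@le_trans _ _ (c * (w t - w s) + B * (e / B))); last first.
    by rewrite [B * _]mulrC divfK// gt_eqF.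
  apply: le_trans (ler_normD _ _) _.
  have := ler_normD (x t - X n (grid_floor T n t) + (X n (grid_floor T n s) - x s))
     (A (Z t' - Z t) + A (Z s - Z s')).
  have := ler_normD (x t - X n (grid_floor T n t)) (X n (grid_floor T n s) - x s).
  have := ler_normD (A (Z t' - Z t)) (A (Z s - Z s')).
  rewrite (distrC (x t)) /B !mulrDl.
  lra.
exists x; split.
- apply/eqP; rewrite -subr_eq0 -normr_le0; apply/ler_addgt0Pr => e e0.
  have [|n /= ne] := filter_ex (near_x 0 e _ e0); first by rewrite lexx ltW.
  by rewrite add0r ltW// distrC; move: ne; rewrite grid_floor0.
- move=> s t s0 st tT.
  have sT : 0 <= s <= T by rewrite s0 (le_trans st).
  have tT' : 0 <= t <= T by rewrite tT (le_trans s0).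
  rewrite -[X in `|X|](subr0 (x t - x s)).
  apply: (limit_ineq (fun=> 0)) => // [y z|y|e e0].
  + by rewrite addr0.
  + by rewrite normr0 mulr_ge0.
  + apply: filterS filterT => n _ /=; rewrite subr0.
    apply: le_trans (X_lip _) _; last by rewrite lerDl ltW.
    by rewrite le_grid_floor// grid_floor_bound.
- move=> e e0; have [h h0 ah] := a_unif e0.
  have Mp : 0 < M + 1 by rewrite ltr_pwDr.
  (* Between a node and the rounding of [u] the polygon then moves by at most [h / 2]; the other
     [h / 2] is for its distance to [x u]. *)
  have [h1 h10 wh] := w_unif (divr_gt0 (divr_gt0 h0 (ltr0n _ 2)) Mp).
  pose k := Num.min h h1.
  have k0 : 0 < k by rewrite lt_min h0.
  (* The rest of [k] pays for rounding: nodes between the roundings of [s] and [t] stay within [k]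
     of [u]. *)
  exists (k / 2); first by rewrite divr_gt0.
  move=> s t u s0 su ut tT tsh.
  have sT : 0 <= s <= T by rewrite s0 (le_trans su)// (le_trans ut).
  have tT' : 0 <= t <= T by rewrite tT (le_trans s0)// (le_trans su).
  have uT : 0 <= u <= T by rewrite (le_trans s0)// (le_trans ut).
  apply: limit_ineq => //.
  + by move=> y; exact: a_bound.
  + exact: ltW.
  move=> e' e'0; have k4 : 0 < k / 4 by rewrite divr_gt0.
  have h2 : 0 < h / 2 by rewrite divr_gt0.
  apply: filterS (filterI (ultra_inv_lt Goo (T + T) k4) (near_x _ _ uT h2)).
  move=> n /= [nk nu]; have gn v := @grid_floor_dist _ T T_gt0 n v.
  have kh : k <= h by rewrite ge_min lexx.
  have kh1 : k <= h1 by rewrite ge_min lexx orbT.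
  rewrite mulrDl in nk.
  apply: le_trans (_ : e * (w (grid T n (grid_floor T n t)) -
     w (grid T n (grid_floor T n s))) <= _); last by rewrite lerDl ltW.
  apply: euler_increment => //; last first.
  + move=> l y /andP[sl lt].
    have lT : 0 <= grid T n l <= T.
      apply: grid_itv => //; apply: leq_trans (ltnW lt) _.
      exact: grid_floor_bound.
    have gsl := ler_grid T_gt0 n sl; have glt := ler_grid T_gt0 n (ltnW lt).
    have := gn s s0; have := grid_floor_le T_gt0 n (le_trans s0 (le_trans su ut)).
    have := gn u (le_trans s0 su).
    move: (T / n.+1%:R) nk => q nk; rewrite !ltr_norml.
    move=> /andP[u1 u2] t1 /andP[s1 _].
    apply: ah => //; first by rewrite ltr_norml; apply/andP; split; lra.
    rewrite -(subrK (X n (grid_floor T n u)) (euler (grid T n) l)) -addrA.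
    apply: le_lt_trans (ler_normD _ _) _; rewrite (splitr h).
    apply: ler_ltD => //.
    have X_near i j : (i <= j <= n.+1)%N -> grid T n j - grid T n i < h1 ->
        `|X n j - X n i| <= h / 2.
      move=> /andP[ij jn] gij; apply: le_trans (X_lip _) _; first by rewrite ij.
      have ij' := ler_grid T_gt0 n ij.
      have : `|w (grid T n j) - w (grid T n i)| < h / 2 / (M + 1).
        apply: wh; [exact: grid_itv|by apply: grid_itv => //; exact: leq_trans jn|].
        by rewrite ger0_norm// subr_ge0.
      move=> /(le_lt_trans (ler_norm _)); rewrite ltr_pdivlMr// mulrDr mulr1.
      move=> wlt; rewrite mulrC; apply: le_trans (ltW wlt); rewrite lerDl subr_ge0.
      apply: w_nd => //; last by have /andP[] := grid_itv T_gt0 jn.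
      by have /andP[] := grid_itv T_gt0 (leq_trans ij jn).
    have [lu|/ltnW ul] := leqP l (grid_floor T n u).
      rewrite distrC; apply: X_near; last by lra.
      by rewrite lu grid_floor_bound//; lra.
    apply: X_near; last by lra.
    by rewrite ul (leq_trans (ltnW lt))// grid_floor_bound.
  + by rewrite le_grid_floor// (le_trans su).
  + exact: ltW.
  + by move=> l lt; apply: grid_step; apply: leq_trans lt (grid_floor_bound _ _ _).
Qed.
End controlled_equation.

(** * Primitives of Lebesgue measurable functions *)

Section abstract_measure.
Context d (X : measurableType d) (R : realType).
Variables (mu : {measure set X -> \bar R}) (D : set X).
Hypothesis mD : measurable D.

Lemma measurable_norm (f : X -> R) :
  measurable_fun D f -> measurable_fun D (fun t => `|f t|).
Proof. by move=> mf; apply: measurableT_comp. Qed.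

Lemma measurable_scale (f : X -> R) (C : R) :
  measurable_fun D f -> measurable_fun D (fun t => C * f t).
Proof. by move=> mf; apply: measurableT_comp. Qed.

Lemma measurable_norm_EFin (f : X -> R) :
  measurable_fun D f -> measurable_fun D (fun t => (`|f t|)%:E).
Proof.
by move=> mf; apply/measurable_EFinP; exact: measurable_norm.
Qed.

Lemma ge0_integral_dominated_lty (f g : X -> R) :
  measurable_fun D f -> measurable_fun D g ->
  (forall t, D t -> 0 <= f t <= g t) ->
  (\int[mu]_(t in D) (g t)%:E < +oo)%E -> (\int[mu]_(t in D) (f t)%:E < +oo)%E.
Proof.
move=> mf mg fg; apply: le_lt_trans; apply: ge0_le_integral => //.
- by move=> t /fg /andP[? _]; rewrite lee_fin.
- exact/measurable_EFinP.
- exact/measurable_EFinP.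
- by move=> t /fg /andP[_ ?]; rewrite lee_fin.
Qed.

Lemma ge0_integralZ_lty (f : X -> R) (C : R) :
  measurable_fun D f -> (forall t, D t -> 0 <= f t) -> 0 <= C ->
  (\int[mu]_(t in D) (f t)%:E < +oo)%E -> (\int[mu]_(t in D) (C * f t)%:E < +oo)%E.
Proof.
move=> mf f0 C0 fi; rewrite (eq_integral (fun t => C%:E * (f t)%:E)%E) //.
rewrite ge0_integralZl_EFin//; first by rewrite lte_mul_pinfty.
  exact/measurable_EFinP.
Qed.

End abstract_measure.

Section lebesgue_measurable_functions.
Context {R : realType}.
Notation mu := (@lebesgue_measure R).
Notation leb := (@completed_lebesgue_measure R).

Lemma borel_lebesgue_measurable (A : set R) :
  @measurable _ (measurableTypeR R) A -> @measurable _ (lebesgueType R) A.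
Proof. exact: sub_caratheodory. Qed.

Lemma ae_lebesgue_completed (P : R -> Prop) :
  {ae mu, forall t, P t} -> {ae leb, forall t, P t}.
Proof.
move=> [B [mB B0 PB]]; exists B; split => //.
exact: borel_lebesgue_measurable.
Qed.

Lemma lebesgue_borel_decomposition (A : set R) :
  @measurable _ (lebesgueType R) A -> exists X B : set R,
  [/\ @measurable _ (measurableTypeR R) X,
      @measurable _ (measurableTypeR R) B, mu B = 0%E, X `<=` A &
      A `\` X `<=` B].
Proof.
move=> mA.
have : (completed_algebra_gen mu).-sigma.-measurable A.
  by rewrite completed_caratheodory_measurable.
rewrite g_sigma_completed_algebra_genE => -[X mX [N [B [mB B0 NB]] <-]].
by exists X, B; split => // t [[Xt|/NB//]] /(_ Xt).
Qed.

Let rat_of (n : nat) : R := ratr (odflt 0%Q (unpickle n)).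

Let rat_between (x y : R) : x < y -> exists n, x < rat_of n < y.
Proof.
move=> /rat_in_itvoo[q]; rewrite in_itv /= => qP.
by exists (pickle q); rewrite /rat_of pickleK.
Qed.

(* Each set [v > q], [q] rational, is Borel up to a null set; off the countable
   union of these null sets [v] is Borel measurable. *)
Lemma borel_modification (D : set R) (v : R -> R) :
  @measurable _ (measurableTypeR R) D ->
  @measurable_fun _ _ (lebesgueType R) (measurableTypeR R) D v ->
  exists N : set R, [/\ @measurable _ (measurableTypeR R) N, mu N = 0%E &
    @measurable_fun _ _ (measurableTypeR R) (measurableTypeR R) setT
      (v \_ (D `\` N))].
Proof.
move=> mD mv.
have dec n : exists XB : set R * set R,
    [/\ @measurable _ (measurableTypeR R) XB.1,
        @measurable _ (measurableTypeR R) XB.2, mu XB.2 = 0%E,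
        XB.1 `<=` D `&` v @^-1` `]rat_of n, +oo[ &
        (D `&` v @^-1` `]rat_of n, +oo[) `\` XB.1 `<=` XB.2].
  have [|X [B ?]] :=
      @lebesgue_borel_decomposition (D `&` v @^-1` `]rat_of n, +oo[).
    by apply: mv; [exact: borel_lebesgue_measurable|exact: measurable_itv].
  by exists (X, B).
have [XB XBP] := choice dec.
pose N := \bigcup_n (XB n).2.
have mN : @measurable _ (measurableTypeR R) N.
  by apply: bigcupT_measurable => n; have [] := XBP n.
exists N; split => //.
  apply/negligibleP => //; apply: negligible_bigcup => n.
  by have [_ mB B0 _ _] := XBP n; apply/negligibleP.
have mDN := measurableD mD mN; apply: (iffLR (measurable_restrictT v mDN)).
apply: (measurability _ (RGenOInfty.measurableE R)) => // _ [_ [x ->] <-].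
(* Off [N], the set where [v > x] is the union of the Borel parts belonging to the rationals above
   [x]. *)
rewrite (_ : _ `&` _ =
    (D `\` N) `&` \bigcup_(n in [set n | x < rat_of n]) (XB n).1).
  apply: measurableI => //.
  by apply: bigcup_measurable => n _; have [] := XBP n.
apply/seteqP; split => [t [[Dt Nt]]|t [[Dt Nt] [n /= xn Xt]]].
  rewrite /= in_itv /= andbT => /rat_between[n /andP[xn nv]].
  split=> //; exists n => //; have [_ _ _ _ XBn] := XBP n.
  apply: contrapT => Xt; apply: Nt; exists n => //; apply: XBn; split => //.
  by split => //=; rewrite in_itv /= nv.
split => //; have [_ _ _ /(_ _ Xt)[_ /=] + _] := XBP n.
by rewrite !in_itv /= !andbT; exact: lt_trans.
Qed.

(** The identity is measurable from Lebesgue to Borel sets and pushes the completed measure forward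
    to [mu], so this is a change of variables. *)
Lemma completed_integral_ge0 (f : R -> \bar R) :
  @measurable_fun _ _ (measurableTypeR R) _ setT f -> (forall t, 0 <= f t)%E ->
  (\int[mu]_t f t = \int[leb]_t f t)%E.
Proof.
move=> mf f0.
have mid : @measurable_fun _ _ (lebesgueType R) (measurableTypeR R) setT idfun.
  by move=> _ Y mY; rewrite setTI; exact: borel_lebesgue_measurable.
have := @ge0_integral_pushforward _ _ (lebesgueType R) (measurableTypeR R) R
  idfun mid leb setT f measurableT mf (fun t _ => f0 t).
rewrite preimage_setT => <-.
by apply: eq_measure_integral.
Qed.

Lemma borel_lebesgue_measurable_fun d (Y : measurableType d) (D : set R)
    (v : R -> Y) :
  @measurable _ (measurableTypeR R) D ->
  @measurable_fun _ _ (measurableTypeR R) Y D v ->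
  @measurable_fun _ _ (lebesgueType R) Y D v.
Proof. by move=> mD mv _ B mB; apply: borel_lebesgue_measurable; exact: mv. Qed.

(** Absolute continuity of the integral, applied to the union of the half-open intervals [F i],
    which are disjoint even if the closed ones share end points. *)
Lemma primitive_absolutely_continuous (v : R -> R) (a b : R) :
  mu.-integrable setT (EFin \o v) ->
  absolutely_continuous a b (fun t => \int[mu]_(s in `]-oo, t]) `|v s| : R^o).
Proof.
move=> iv e e0; have [d [d0 dv]] := integral_normr_continuous iv e0.
have inv D : measurable D -> mu.-integrable D (EFin \o (fun s => `|v s|)).
  move=> mD; apply: (@integrableS _ _ _ mu setT) => //.
  exact: integrable_norm.
exists d => // n c c' cc' dis sum_lt.
pose F (i : 'I_n) : set R := [set` `]c i, c' i]].
have mF i : measurable (F i) by exact: measurable_itv.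
have tF : trivIset [set` index_enum 'I_n] F.
  apply/trivIsetP => i j _ _ ij; apply/seteqP; split => // t [].
  rewrite /F /= !in_itv /= => /andP[it ti] /andP[jt tj].
  have [h|h] := dis i j ij.
    by move: (le_lt_trans (le_trans ti h) jt); rewrite ltxx.
  by move: (le_lt_trans (le_trans tj h) it); rewrite ltxx.
have mD : measurable (\big[setU/set0]_(i <- index_enum 'I_n) F i).
  exact: bigsetU_measurable.
have D_lt : (mu (\big[setU/set0]_(i <- index_enum 'I_n) F i) < d%:E)%E.
  rewrite -[X in (X < _)%E]mul1e -integral_cst// integral_bigsetU_EFin//; last 2 first.
  - exact: index_enum_uniq.
  - exact: measurable_cst.
  rewrite (eq_bigr (fun i => (c' i - c i)%:E)); first by rewrite sumEFin lte_fin.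
  move=> i _; have -> : (\int[mu]_(_ in F i) 1 = 1 * mu (F i))%E.
    exact: (integral_cst mu (mF i) 1%E).
  rewrite mul1e /F /= lebesgue_measure_itv /= lte_fin.
  case: ltP => // h; have [_ [h' _]] := cc' i.
  by rewrite (le_anti (introT andP (conj h h'))) subrr.
apply: le_lt_trans (dv _ mD D_lt).
have RE D : measurable D ->
    (\int[mu]_(s in D) `|v s|)%:E = (\int[mu]_(s in D) `|v s|%:E)%E.
  by move=> mD'; rewrite fineK//; exact: (integrable_fin_num mD' (inv _ mD')).
rewrite -lee_fin -sumEFin RE// integral_bigsetU_EFin//; last 2 first.
- exact: index_enum_uniq.
- by have /integrableP[] := inv _ mD.
apply: lee_sum => i _; have [_ [h' _]] := cc' i.
rewrite -(RE _ (mF i)) lee_fin Rintegral_itvB//; last by apply: inv; exact: measurable_itv.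
by rewrite ger0_norm// Rintegral_ge0.
Qed.

(** Both primitives are those of a Borel modification [v'] of [v], extended by 0 to the line, where
    the fundamental theorem of calculus applies; the null set [N] joins the exceptional points. [W]
    is the primitive of [|v'|]. *)
Lemma lebesgue_primitive (T : R) (v : R -> R) :
  @measurable_fun _ _ (lebesgueType R) (measurableTypeR R) `[0, T] v ->
  (\int[leb]_(t in `[0%R, T]) (`|v t|)%:E < +oo)%E ->
  exists V W : R -> R, [/\
    forall s t, s <= t -> `|V t - V s| <= W t - W s,
    absolutely_continuous 0 T (W : R -> R^o) &
    {ae leb, forall t : R, t \in `[0, T] ->
      is_derive t (1 : R) (V : R -> R^o) (v t) /\
      derivable (W : R -> R^o) t 1}].
Proof.
move=> mv iv.
have mD : @measurable _ (measurableTypeR R) `[0, T] by exact: measurable_itv.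
have [N [mN N0 mvN]] := borel_modification mD mv.
set v' := v \_ _ in mvN.
have v'v t : `|v' t| <= (fun s => `|v s|) \_ `[0, T] t.
  rewrite /v' /patch; case: ifPn => [|_]; last first.
    by rewrite normr0; case: ifPn.
  by rewrite inE => -[Dt _]; rewrite ifT ?inE.
have mDl : @measurable _ (lebesgueType R) `[0, T].
  exact: borel_lebesgue_measurable.
have iv' : mu.-integrable setT (EFin \o v').
  apply/integrableP; split; first exact/measurable_EFinP.
  have mnv' := measurable_norm_EFin mvN.
  rewrite completed_integral_ge0//.
  rewrite (_ : (fun t => _) = fun t => (`|v' t|)%:E)//.
  have iv2 : (\int[leb]_t (((fun s => `|v s|) \_ `[0%R, T]) t)%:E < +oo)%E.
    move: iv; rewrite integral_mkcond.
    rewrite (_ : (fun t => _) \_ _ = fun t => (((fun s => `|v s|) \_ `[0%R, T]) t)%:E)//.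
    by apply/funext => t; rewrite /patch; case: ifPn.
  move: iv2; apply: (@ge0_integral_dominated_lty _ (lebesgueType R) R leb setT).
  - exact: measurableT.
  - apply: borel_lebesgue_measurable_fun; first exact: measurableT.
    exact/measurable_EFinP.
  - apply: (iffLR (measurable_restrictT _ mDl)).
    apply: (iffLR (measurable_EFinP _ _)).
    exact: (measurable_norm_EFin mv).
  - by move=> t _; rewrite normr_ge0 v'v.
have inv D : measurable D -> mu.-integrable D (EFin \o v').
  by move=> mD'; apply: (@integrableS _ _ _ mu setT).
have innv : mu.-integrable setT (EFin \o (fun s => `|v' s|)).
  exact: integrable_norm.
have innvD D : measurable D -> mu.-integrable D (EFin \o (fun s => `|v' s|)).
  by move=> mD'; apply: (@integrableS _ _ _ mu setT).
exists (fun t => \int[mu]_(s in `]-oo, t]) v' s),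
  (fun t => \int[mu]_(s in `]-oo, t]) `|v' s|); split.
- move=> s t st; rewrite !Rintegral_itvB//; do ?[exact: inv|exact: innvD].
  by apply: le_normr_Rintegral => //; apply: inv.
- exact: primitive_absolutely_continuous.
have loc f : mu.-integrable setT (EFin \o f) -> locally_integrable [set: R] f.
  by move=> fi; apply: open_integrable_locally => //; exact: openT.
have FV := FTC1Ny (fun y => inv _ (measurable_itv `]-oo, y])) (loc _ iv').
have FW := FTC1Ny (fun y => innvD _ (measurable_itv `]-oo, y])) (loc _ innv).
have Nn : {ae mu, forall t, ~ N t}.
  by exists N; split => // t /= /contrapT.
apply: ae_lebesgue_completed; move: FV FW Nn.
apply: filterS3; first exact: (ae_filter_ringOfSetsType mu).
move=> t [dV eV] [dW _] Nt tT; split; last exact: dW.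
apply: DeriveDef; first exact: dV.
rewrite -derive1E eV /v' /patch ifT// inE; split; last exact: Nt.
by move: tT.
Qed.

End lebesgue_measurable_functions.

(** * Derivatives as first-order expansions *)

Section derivatives.
Context {R : realType} (V : normedModType R).

(** Without a quotient the derivative has the shape of the expansion of the Euler limit, and [s = t]
    is no exception. *)
Lemma is_derive_normP (x : R -> V) (t : R) (d : V) :
  is_derive t (1 : R) x d <->
  forall e, 0 < e -> exists2 h, 0 < h & forall s, `|s - t| < h ->
    `|x s - x t - (s - t) *: d| <= e * `|s - t|.
Proof.
pose q := fun h : R => h^-1 *: ((x \o shift t) (h *: (1 : R)) - x t).
have qE h : q h = h^-1 *: (x (h + t) - x t).
  by congr (_ *: (x (_ + _) - _)); exact: mulr1.
have key : q h @[h --> 0^'] --> d <->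
  forall e, 0 < e -> exists2 h, 0 < h & forall s, `|s - t| < h ->
    `|x s - x t - (s - t) *: d| <= e * `|s - t|.
  split=> [/cvgrPdist_le qd e e0|H].
    have [h /= h0 hq] := qd _ e0; exists h => // s sth.
    have [->|st0] := eqVneq s t.
      by rewrite !subrr scale0r subrr !normr0 mulr0.
    have st1 : s - t != 0 by rewrite subr_eq0.
    have := hq (s - t); rewrite /ball_ /= sub0r normrN => /(_ sth st1).
    rewrite qE subrK => H1.
    have -> : x s - x t - (s - t) *: d =
        - ((s - t) *: (d - (s - t)^-1 *: (x s - x t))).
      by rewrite scalerBr scalerA divff// scale1r opprB.
    by rewrite normrN normrZ mulrC ler_wpM2r.
  apply/cvgrPdist_le => e e0; have [h h0 hx] := H _ e0.
  exists h => // s; rewrite /ball_ /= sub0r normrN => sh s0.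
  have := hx (s + t); rewrite addrK => /(_ sh).
  rewrite qE => H1.
  have -> : d - s^-1 *: (x (s + t) - x t) = - (s^-1 *: (x (s + t) - x t - s *: d)).
    by rewrite [in RHS]scalerBr scalerA mulVf// scale1r opprB.
  by rewrite normrN normrZ normfV mulrC ler_pdivrMr// normr_gt0.
rewrite -key; split => [[dx <-]|qd]; first exact: dx.
by apply: DeriveDef; [apply/cvg_ex; exists d|apply/cvg_lim => //].
Qed.

End derivatives.

Lemma is_derive_scale (R : realType) (V : normedModType R) (f : R -> R)
    (t d : R) (v : V) :
  is_derive t (1 : R) (f : R -> R^o) d ->
  is_derive t (1 : R) (fun s => f s *: v) (d *: v).
Proof.
move=> /is_derive_normP fd; apply/is_derive_normP => e e0.
have v0 : 0 < `|v| + 1 by rewrite ltr_wpDl.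
have [h h0 fh] := fd _ (divr_gt0 e0 v0); exists h => // s /fh fs.
rewrite scalerA -!scalerBl normrZ.
apply: le_trans (ler_wpM2r (normr_ge0 v) fs) _.
rewrite mulrAC ler_wpM2r// mulrAC ler_pdivrMr// ler_pM2l//.
by rewrite lerDl.
Qed.

Lemma absolutely_continuous_sum (R : realType) (a b : R) (I : Type) (r : seq I)
    (c : I -> R) (f : I -> R -> R) :
  (forall i, absolutely_continuous a b (f i : R -> R^o)) ->
  absolutely_continuous a b ((fun t => \sum_(i <- r) c i * f i t) : R -> R^o).
Proof.
move=> acf; elim: r => [|i r IH] e e0.
  exists 1 => // n x y _ _ _; rewrite big1// => j _.
  by rewrite !big_nil subrr normr0.
have c0 : 0 < `|c i| + 1 by rewrite ltr_wpDl.
have e2 : 0 < e / 2 by rewrite divr_gt0.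
have [d d0 fd] := acf i _ (divr_gt0 e2 c0).
have [d' d'0 rd] := IH _ e2.
exists (Num.min d d'); first by rewrite lt_min d0.
move=> n x y xy dis; rewrite lt_min => /andP[s1 s2].
rewrite (splitr e).
apply: le_lt_trans (_ : _ <= (`|c i| + 1) * \sum_(j < n) `|f i (y j) - f i (x j)| +
  \sum_(j < n) `|\sum_(k <- r) c k * f k (y j) - \sum_(k <- r) c k * f k (x j)|) _.
  rewrite mulr_sumr -big_split /=; apply: ler_sum => j _.
  rewrite !big_cons opprD addrACA; apply: le_trans (ler_normD _ _) _.
  rewrite lerD2r -mulrBr normrM ler_wpM2r// lerDl //.
apply: ltrD; last exact: rd.
by rewrite mulrC -ltr_pdivlMr//; exact: fd.
Qed.

Section vector_primitive.
Context {R : realType}.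
Notation leb := (@completed_lebesgue_measure R).

Lemma lebesgue_measurable_continuous (V : normedModType R) (D : set R)
    (u : R -> V) (c : V -> R) :
  continuous c -> lebesgue_measurable D u ->
  @measurable_fun _ _ (lebesgueType R) (measurableTypeR R) D (c \o u).
Proof.
move=> cc mu mD; apply: (measurability _ (RGenOInfty.measurableE R)) => //.
move=> _ [_ [x ->] <-].
rewrite (_ : _ `&` _ = D `&` u @^-1` (c @^-1` `]x, +oo[))//.
apply: mu => //; apply: sub_sigma_algebra.
by apply: open_comp => // y _; exact: cc.
Qed.

Lemma lebesgue_vector_primitive (E : normedVectType R) (T : R) (u : R -> E) :
  lebesgue_measurable `[0, T] u ->
  (\int[leb]_(t in `[0%R, T]) (`|u t|)%:E < +oo)%E ->
  exists (V : R -> E) (W : R -> R), [/\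
    forall s t, s <= t -> `|V t - V s| <= W t - W s,
    absolutely_continuous 0 T (W : R -> R^o) &
    {ae leb, forall t : R, t \in `[0, T] ->
      is_derive t (1 : R) V (u t) /\ derivable (W : R -> R^o) t 1}].
Proof.
move=> mu iu; pose b := vbasis {:E}; pose n := \dim {:E}.
have mD : @measurable _ (lebesgueType R) `[0, T].
  by apply: borel_lebesgue_measurable; exact: measurable_itv.
have [C C0 CE] := coord_bounded E.
have cc (i : 'I_n) : continuous (coord b i : E -> R^o).
  apply: (@norm_bounded_linear_continuous R E R^o (coord b i) C) => v.
  exact: CE.
have mc (i : 'I_n) := lebesgue_measurable_continuous (cc i) mu.
have mnu : @measurable_fun _ _ (lebesgueType R) (measurableTypeR R) `[0, T]
    (fun t => `|u t|).
  exact: (lebesgue_measurable_continuous (@norm_continuous _ E) mu).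
have ic (i : 'I_n) :
    (\int[leb]_(t in `[0%R, T]) (`|coord b i (u t)|)%:E < +oo)%E.
  move: iu => /(ge0_integralZ_lty mD mnu (fun t _ => normr_ge0 _) (ltW C0)).
  apply: (ge0_integral_dominated_lty mD).
  - exact: (measurable_norm (mc i)).
  - exact: (measurable_scale C mnu).
  - by move=> t _; rewrite normr_ge0 CE.
have ex (i : 'I_n) : exists VW : (R -> R) * (R -> R), [/\
    forall s t, s <= t -> `|VW.1 t - VW.1 s| <= VW.2 t - VW.2 s,
    absolutely_continuous 0 T (VW.2 : R -> R^o) &
    {ae leb, forall t : R, t \in `[0, T] ->
      is_derive t (1 : R) (VW.1 : R -> R^o) (coord b i (u t)) /\
      derivable (VW.2 : R -> R^o) t 1}].
  by have [V [W ?]] := lebesgue_primitive (mc i) (ic i); exists (V, W).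
have [VW VWP] := choice ex.
exists (fun t => \sum_(i < n) (VW i).1 t *: b`_i),
  (fun t => \sum_(i < n) `|b`_i| * (VW i).2 t); split.
- move=> s t st; rewrite -!sumrB.
  apply: le_trans (ler_norm_sum _ _ _) _; apply: ler_sum => i _.
  rewrite -scalerBl normrZ mulrC -mulrBr ler_wpM2l//.
  by have [VWi _ _] := VWP i; exact: VWi.
- by apply: absolutely_continuous_sum => i; have [_ + _] := VWP i.
(* The finitely many null sets are merged through a quantifier over [nat], which is vacuous from [n]
   on. *)
have : {ae leb, forall t, forall k : nat, forall i : 'I_n, i = k :> nat ->
    t \in `[0, T] -> is_derive t (1 : R) ((VW i).1 : R -> R^o) (coord b i (u t)) /\
    derivable ((VW i).2 : R -> R^o) t 1}.
  apply: ae_foralln => k; have [kn|nk] := ltnP k n; last first.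
    by apply: aeW => t i ik; move: (ltn_ord i); rewrite ik ltnNge nk.
  have [_ _] := VWP (Ordinal kn).
  apply: filterS; first exact: (ae_filter_ringOfSetsType leb).
  move=> t H i ik tT; have -> : i = Ordinal kn by exact: val_inj.
  exact: H.
apply: filterS; first exact: (ae_filter_ringOfSetsType leb).
move=> t H tT; split.
  rewrite [X in is_derive _ _ _ X](coord_expand (u t)).
  rewrite (_ : (fun t => _) = \sum_(i < n) (fun s => (VW i).1 s *: b`_i)); last first.
    by apply/funext => s; rewrite fct_sumE.
  by apply: is_derive_sum => i; apply: is_derive_scale; have [] := H i i erefl tT.
rewrite (_ : (fun t => _) = \sum_(i < n) (`|b`_i| \*: ((VW i).2 : R -> R^o))); last first.
  by apply/funext => s; rewrite fct_sumE.
by apply: derivable_sum => i; apply: derivableZ; have [] := H i i erefl tT.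
Qed.

End vector_primitive.

(** * Existence of global solutions *)

Section operator_norm.
Context {R : realType}.

Lemma op_norm_le (V W : normedModType R) (A : V -> W) C :
  (forall v, `|v| <= 1 -> `|A v| <= C) -> op_norm A <= C.
Proof.
move=> AC; apply: sup_le_ub.
  by exists `|A 0|, 0 => //=; rewrite normr0.
by move=> _ [v /= v1 <-]; exact: AC.
Qed.

Lemma bounded_op_norm_ge0 (V W : normedModType R) (A : {linear V -> W}) C :
  (forall v, `|A v| <= C * `|v|) -> 0 <= op_norm A.
Proof.
move=> AC; apply: ub_le_sup; last by exists 0; rewrite /= ?linear0 normr0.
exists `|C| => _ [w /= w1 <-]; apply: le_trans (AC w) _.
rewrite -[leRHS]mulr1; apply: le_trans (ler_wpM2l (normr_ge0 C) w1).
by apply: ler_wpM2r => //; exact: ler_norm.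
Qed.

Variables (E : normedVectType R) (W : normedVectType R).

Lemma le_op_norm (A : 'Hom(E, W)) v : `|A v| <= op_norm A * `|v|.
Proof.
have [C _ AC] := linear_bounded_finite A.
exact: (op_norm_ge (A := A) v AC).
Qed.

Lemma op_norm_ge0 (A : 'Hom(E, W)) : 0 <= op_norm A.
Proof.
have [C _ AC] := linear_bounded_finite A.
exact: (bounded_op_norm_ge0 (A := A) AC).
Qed.

Lemma op_norm_distr (A B : 'Hom(E, W)) : op_norm (A - B) = op_norm (B - A).
Proof.
congr (sup _); apply/seteqP; split => _ [v v1 <-]; exists v => //;
  by rewrite !lfunE /= !lfunE /= distrC.
Qed.

Lemma op_norm_triangle (A B C : 'Hom(E, W)) :
  op_norm (A - C) <= op_norm (A - B) + op_norm (B - C).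
Proof.
apply: op_norm_le => v v1.
have -> : (A - C) v = (A - B) v + (B - C) v.
  by rewrite !lfunE /= !lfunE /= addrA subrK.
apply: le_trans (ler_normD _ _) _; apply: lerD;
  by apply: le_trans (le_op_norm _ _) _; rewrite ler_piMr// op_norm_ge0.
Qed.

End operator_norm.

Section radial_retraction.
Context {R : realType} (E : normedModType R) (rho : R).
Hypothesis rho_gt0 : 0 < rho.

(** The maximum makes the factor 1 inside the ball, without a case distinction. *)
Definition retract (x : E) : E := (rho / Num.max rho `|x|) *: x.

Lemma retract_id x : `|x| <= rho -> retract x = x.
Proof. by move=> xr; rewrite /retract max_l// divff ?gt_eqF// scale1r. Qed.

Lemma retract_norm x : `|retract x| <= rho.
Proof.
have m0 : 0 < Num.max rho `|x| by rewrite lt_max rho_gt0.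
rewrite /retract normrZ ger0_norm; last by rewrite divr_ge0// ltW.
rewrite mulrAC ler_pdivrMr// ler_pM2l//.
by rewrite le_max lexx orbT.
Qed.

(** The norm is arbitrary, hence the constant 2: one [|x - y|] comes from moving the point, the
    other from the change of the factor, as [Num.max rho] is 1-Lipschitz. *)
Lemma retract_lipschitz x y : `|retract x - retract y| <= 2 * `|x - y|.
Proof.
set a := Num.max rho `|x|; set b := Num.max rho `|y|.
have a0 : 0 < a by rewrite lt_max rho_gt0.
have b0 : 0 < b by rewrite lt_max rho_gt0.
have ar : rho <= a by rewrite le_max lexx.
have yb : `|y| <= b by rewrite le_max lexx orbT.
have ab : `|a - b| <= `|x - y|.
  have := ler_dist_dist x y; rewrite !ler_norml => /andP[h1 h2].
  have xy0 := normr_ge0 (x - y).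
  by rewrite /a /b; apply/andP; split; case: (leP rho `|x|) => ?;
    case: (leP rho `|y|) => ?; lra.
have -> : retract x - retract y = (rho / a) *: (x - y) + (rho / a - rho / b) *: y.
  by rewrite scalerBr scalerBl addrA subrK.
apply: le_trans (ler_normD _ _) _; rewrite mulrDl mul1r; apply: lerD.
  rewrite normrZ ger0_norm; last by rewrite divr_ge0// ltW.
  by rewrite ler_piMl// ler_pdivrMr// mul1r.
rewrite normrZ (_ : rho / a - rho / b = rho / a * ((b - a) / b)); last first.
  by field; rewrite !gt_eqF.
rewrite !normrM normfV (ger0_norm (ltW a0)) (ger0_norm (ltW rho_gt0)).
rewrite normfV (ger0_norm (ltW b0)) -!mulrA.
apply: (@le_trans _ _ (1 * (`|b - a| * 1))); last by rewrite mul1r mulr1 distrC.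
rewrite mulrA; apply: ler_pM => //.
- by rewrite divr_ge0// ltW.
- by rewrite !mulr_ge0// invr_ge0 ltW.
- by rewrite ler_pdivrMr// mul1r.
- by rewrite ler_wpM2l// mulrC ler_pdivrMr// mul1r.
Qed.

End radial_retraction.

Section absolute_continuity.
Context {R : realType} (a b : R).

Lemma absolutely_continuous_le (V : normedModType R) (x : R -> V) (w : R -> R) M :
  0 <= M -> absolutely_continuous a b (w : R -> R^o) ->
  (forall s t, a <= s -> s <= t -> t <= b -> `|x t - x s| <= M * (w t - w s)) ->
  absolutely_continuous a b x.
Proof.
move=> M0 acw xw e e0; have M1 : 0 < M + 1 by rewrite ltr_wpDl.
have [d d0 wd] := acw _ (divr_gt0 e0 M1); exists d => // n c c' cc' dis sd.
have := wd n c c' cc' dis sd; rewrite ltr_pdivlMr//; apply: le_lt_trans.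
rewrite mulr_suml; apply: ler_sum => i _; have [h1 [h2 h3]] := cc' i.
apply: le_trans (xw _ _ h1 h2 h3) _; rewrite mulrC.
apply: (@le_trans _ _ (`|w (c' i) - w (c i)| * M)).
  by rewrite ler_wpM2r// ler_norm.
by rewrite ler_wpM2l// lerDl.
Qed.

Lemma absolutely_continuous_id : absolutely_continuous a b (id : R -> R^o).
Proof.
move=> e e0; exists e => // n c c' cc' _; apply: le_lt_trans.
apply: ler_sum => i _; have [_ [h _]] := cc' i.
by rewrite ger0_norm// subr_ge0.
Qed.

Lemma absolutely_continuous_add (V : normedModType R) (x y : R -> V) :
  absolutely_continuous a b x -> absolutely_continuous a b y ->
  absolutely_continuous a b (fun t => x t + y t).
Proof.
move=> acx acy e e0; have e2 : 0 < e / 2 by rewrite divr_gt0.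
have [d d0 xd] := acx _ e2; have [d' d'0 yd] := acy _ e2.
exists (Num.min d d'); first by rewrite lt_min d0.
move=> n c c' cc' dis; rewrite lt_min => /andP[s1 s2].
apply: le_lt_trans (_ : _ <= \sum_(i < n) `|x (c' i) - x (c i)| +
   \sum_(i < n) `|y (c' i) - y (c i)|) _.
  rewrite -big_split; apply: ler_sum => i _.
  by rewrite opprD addrACA ler_normD.
by rewrite (splitr e) ltrD//; [exact: xd|exact: yd].
Qed.

Lemma absolutely_continuous_uniform (V : normedModType R) (x : R -> V) e :
  absolutely_continuous a b x -> 0 < e -> exists2 h, 0 < h & forall s t,
    a <= s <= b -> a <= t <= b -> `|s - t| < h -> `|x s - x t| < e.
Proof.
move=> acx e0; have [d d0 xd] := acx _ e0; exists d => //.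
have main s t : a <= s <= b -> a <= t <= b -> s <= t -> t - s < d ->
    `|x t - x s| < e.
  move=> /andP[s1 s2] /andP[t1 t2] st ts.
  have := xd 1%N (fun=> s) (fun=> t); rewrite !big_ord1; apply => //.
  by move=> i j; rewrite !ord1 eqxx.
move=> s t sb tb sth; have [st|/ltW ts] := leP s t.
  by rewrite distrC; apply: main => //; apply: le_lt_trans sth; rewrite distrC ler_norm.
by apply: main => //; apply: le_lt_trans sth; rewrite ler_norm.
Qed.

End absolute_continuity.

Lemma within_continuousP (R : realType) (V W : normedModType R) (A : set V)
    (f : V -> W) : {within A, continuous f} ->
  forall z, A z -> forall e, 0 < e -> exists2 h, 0 < h &
    forall y, A y -> `|y - z| < h -> `|f y - f z| < e.
Proof.
move=> /subspace_continuousP cf z Az e e0.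
have /cvgrPdist_lt /(_ _ e0) := cf z Az.
move=> /nbhs_normP[h /= h0 hA]; exists h => // y Ay yz.
by rewrite distrC; apply: hA => //=; rewrite distrC.
Qed.

Lemma prod_norm_le (R : realType) (V W : normedModType R) (z : V * W) a b :
  `|z.1| <= a -> `|z.2| <= b -> 0 <= a -> 0 <= b -> `|z| <= a + b.
Proof.
move=> za zb a0 b0; rewrite prod_normE ge_max.
by rewrite (le_trans za) ?lerDl// (le_trans zb) ?lerDr.
Qed.

Lemma prod_norm_ge (R : realType) (V W : normedModType R) (z : V * W) :
  `|z.1| <= `|z| /\ `|z.2| <= `|z|.
Proof. by rewrite prod_normE !le_max !lexx orbT. Qed.

Section truncated_field.
Context {R : realType} (T rho : R) (E : normedVectType R).
Variables (f : R -> E -> E) (g : R -> E -> 'End(E)).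
Hypotheses (rho_gt0 : 0 < rho) (T_gt0 : 0 < T)
  (f_cont : {within [set z : R * E | z.1 \in `[0, T]],
     continuous (fun z => f z.1 z.2)})
  (g_cont : forall z0 : R * E, z0.1 \in `[0, T] ->
     op_norm (g z.1 z.2 - g z0.1 z0.2)
       @[z --> within [set z : R * E | z.1 \in `[0, T]] (nbhs z0)] --> 0).

Let D := [set z : R * E | 0 <= z.1 <= T /\ `|z.2| <= rho].

Let P (z z' : R * E) : R :=
  `|f z.1 z.2 - f z'.1 z'.2| + op_norm (g z.1 z.2 - g z'.1 z'.2).

Let compact_D : compact D.
Proof.
rewrite (_ : D = `[0, T]%classic `*` [set x | `|x| <= rho]).
  apply: compact_setX; first exact: segment_compact.
  exact: closed_norm_ball_compact.
by apply/seteqP; split => -[t x] /=; rewrite in_itv.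
Qed.

Let P_sym x y : P x y = P y x.
Proof. by rewrite /P distrC op_norm_distr. Qed.

Let P_tri x y z : D x -> D y -> D z -> P x z <= P x y + P y z.
Proof.
move=> _ _ _; rewrite /P addrACA; apply: lerD; last exact: op_norm_triangle.
exact: ler_distD.
Qed.

Let P_cont z : D z -> forall e, 0 < e -> exists2 h, 0 < h &
  forall x, D x -> `|x - z| < h -> P x z < e.
Proof.
move=> [zT _] e e0; have e2 : 0 < e / 2 by rewrite divr_gt0.
have zT' : z.1 \in `[0, T] by rewrite in_itv.
have [h h0 fh] := within_continuousP f_cont zT' e2.
have /cvgrPdist_lt /(_ _ e2) := g_cont zT'.
move=> /nbhs_normP[k /= k0 kg].
exists (Num.min h k); first by rewrite lt_min h0.
move=> x [xT _]; rewrite lt_min => /andP[xh xk].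
have xT' : x.1 \in `[0, T] by rewrite in_itv.
rewrite /P (splitr e); apply: ltrD; first exact: fh.
have := kg x; rewrite /ball_ /= distrC => /(_ xk xT').
by rewrite sub0r normrN ger0_norm// op_norm_ge0.
Qed.

(** The argument [y] is an increment of time together with one of the primitive of [u], so the state
    equation has a single driving path. The retraction keeps the state in a compact ball, where the
    coefficients are bounded and uniformly continuous. *)
Definition truncated_field (t : R) (x : E) (y : R * E) : E :=
  y.1 *: f t (retract rho x) + g t (retract rho x) y.2.

Lemma truncated_field_additive t x :
  {morph truncated_field t x : y z / y + z}.
Proof.
by move=> y z; rewrite /truncated_field /= scalerDl linearD addrACA.
Qed.

Let in_D t x : 0 <= t <= T -> D (t, retract rho x).
Proof. by move=> tT; split => //=; exact: retract_norm. Qed.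

Let field_dist t x s x' y :
  `|truncated_field t x y - truncated_field s x' y| <=
  P (t, retract rho x) (s, retract rho x') * `|y|.
Proof.
rewrite /truncated_field opprD addrACA -scalerBr.
apply: le_trans (ler_normD _ _) _; rewrite /P mulrDl.
have [y1 y2] := prod_norm_ge y; apply: lerD.
  by rewrite normrZ mulrC ler_wpM2l.
have -> : forall (A B : 'End(E)) v, A v - B v = (A - B) v.
  by move=> A B v; rewrite !lfunE /= !lfunE.
by apply: le_trans (le_op_norm _ _) _; rewrite ler_wpM2l// op_norm_ge0.
Qed.

Lemma truncated_field_bounded : exists2 M, 0 <= M &
  forall t x y, 0 <= t <= T -> `|truncated_field t x y| <= M * `|y|.
Proof.
have r0 : retract rho (0 : E) = 0 by rewrite /retract scaler0.
have D0 : D (0, 0) by split; rewrite /= ?lexx ?normr0 ltW.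
have [M M0 PM] := compact_pseudometric_bounded compact_D P_tri P_cont D0.
exists (M + (`|f 0 0| + op_norm (g 0 0))).
  by rewrite !addr_ge0// op_norm_ge0.
move=> t x y tT.
rewrite -(subrK (truncated_field 0 0 y) (truncated_field t x y)).
apply: le_trans (ler_normD _ _) _; rewrite mulrDl; apply: lerD.
  apply: le_trans (field_dist _ _ _ _ _) _; rewrite ler_wpM2r//.
  by rewrite r0; apply: PM; exact: in_D.
rewrite /truncated_field r0.
apply: le_trans (ler_normD _ _) _; rewrite mulrDl.
have [y1 y2] := prod_norm_ge y; apply: lerD.
  by rewrite normrZ mulrC ler_wpM2l.
by apply: le_trans (le_op_norm _ _) _; rewrite ler_wpM2l// op_norm_ge0.
Qed.

Lemma truncated_field_uniform e : 0 < e -> exists2 h, 0 < h &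
  forall s t x x', 0 <= s <= T -> 0 <= t <= T -> `|s - t| < h ->
    `|x - x'| < h -> forall y,
    `|truncated_field s x y - truncated_field t x' y| <= e * `|y|.
Proof.
move=> e0.
have [h h0 Ph] := compact_pseudometric_uniform compact_D P_sym P_tri P_cont e0.
(* The retraction may double distances, and [|s - t| + 2 * |x - x'|] is below [3 * h / 4]. *)
exists (h / 4); first by rewrite divr_gt0.
move=> s t x x' sT tT st xx' y.
apply: le_trans (field_dist _ _ _ _ _) _; rewrite ler_wpM2r//.
apply/ltW/Ph; [exact: in_D|exact: in_D|].
apply: le_lt_trans (_ : _ <= `|s - t| + 2 * `|x - x'|) _.
  by apply: prod_norm_le; rewrite ?mulr_ge0//; exact: retract_lipschitz.
by move: (`|s - t|) (`|x - x'|) st xx' => p q; lra.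
Qed.

End truncated_field.

Section global_solution.
Context {R : realType} (T B : R) (E : normedVectType R).
Variables (f : R -> E -> E) (g : R -> E -> 'End(E)) (xi : E) (u : R -> E).
Notation leb := (@completed_lebesgue_measure R).
Hypotheses (T_gt0 : 0 < T)
  (f_cont : {within [set z : R * E | z.1 \in `[0, T]],
     continuous (fun z => f z.1 z.2)})
  (g_cont : forall z0 : R * E, z0.1 \in `[0, T] ->
     op_norm (g z.1 z.2 - g z0.1 z0.2)
       @[z --> within [set z : R * E | z.1 \in `[0, T]] (nbhs z0)] --> 0)
  (u_meas : lebesgue_measurable `[0, T] u)
  (u_int : (\int[leb]_(t in `[0%R, T]) (`|u t|)%:E < +oo)%E)
  (a_priori : forall (x : R -> E) (T1 : R), 0 < T1 -> T1 <= T ->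
     solution f g T1 xi x u -> forall t, 0 <= t <= T1 -> `|x t| <= B).

(** The added 1 makes [rho] exceed [B], so that a solution reaching norm [rho] violates the a priori
    bound, and exceed [|xi|], so that the exit time is positive. *)
Let rho : R := Num.max B `|xi| + 1.

Let rho_gt0 : 0 < rho.
Proof. by rewrite ltr_wpDl// le_max normr_ge0 orbT. Qed.

Lemma truncated_solution_exists : exists x : R -> E,
  [/\ absolutely_continuous 0 T x, x 0 = xi &
      {ae leb, forall t : R, t \in `[0, T] ->
        is_derive t (1 : R) x (f t (retract rho (x t))
          + g t (retract rho (x t)) (u t))}].
Proof.
have [V [W [VW acW aeVW]]] := lebesgue_vector_primitive u_meas u_int.
pose w t := t + W t; pose Z t : R * E := (t, V t).
have acw : absolutely_continuous 0 T (w : R -> R^o).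
  exact: (absolutely_continuous_add (absolutely_continuous_id 0 T)).
have Zw s t : 0 <= s -> s <= t -> t <= T -> `|Z t - Z s| <= w t - w s.
  move=> _ st _; rewrite /w opprD addrACA; apply: prod_norm_le => /=.
  - by rewrite ger0_norm// subr_ge0.
  - exact: VW.
  - by rewrite subr_ge0.
  - exact: le_trans (VW _ _ st).
have w_unif e : 0 < e -> exists2 h, 0 < h & forall s t,
    0 <= s <= T -> 0 <= t <= T -> `|s - t| < h -> `|w s - w t| < e.
  exact: absolutely_continuous_uniform.
have [M M0 aM] := truncated_field_bounded rho_gt0 T_gt0 f_cont g_cont.
have [x [x0 xM xZ]] := controlled_equation_solvable xi T_gt0 M0
  (truncated_field_additive rho f g) aM
  (truncated_field_uniform rho_gt0 f_cont g_cont) Zw w_unif.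
exists x; split => //; first exact: absolutely_continuous_le M0 acw xM.
(* The end points are discarded so that [t] has a two-sided neighbourhood in the interval. *)
have ne c : {ae leb, forall t : R, t != c}.
  apply: ae_lebesgue_completed; exists [set c]; split => //.
    exact: lebesgue_measure_set1.
  by move=> t /= /negP; rewrite negbK => /eqP.
move: aeVW (ne 0) (ne T); apply: filterS3.
  exact: (ae_filter_ringOfSetsType leb).
move=> t + t0 tT' tT; move=> /(_ tT)[dV dW].
have {tT t0 tT'} /andP[t0 tT] : 0 < t < T.
  move: tT; rewrite in_itv /= !le_eqVlt => /andP[/orP[/eqP t00|->] /orP[/eqP t01|->]] //.
  - by rewrite -t00 eqxx in t0.
  - by rewrite -t00 eqxx in t0.
  - by rewrite t01 eqxx in tT'.
have [dW' dWP] : exists d, is_derive t (1 : R) (W : R -> R^o) d.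
  by exists ('D_1 (W : R -> R^o) t); exact: DeriveDef.
apply/is_derive_normP => e e0.
(* Near [t] the increments of [w] are at most [C * |s - t|]: 1 from time, [|dW'|] from the
   derivative of [W], and 1 from its remainder. *)
pose C : R := `|dW'| + 2.
have C0 : 0 < C by rewrite ltr_wpDl.
have [h1 h10 H1] := (proj1 (is_derive_normP _ _ _)) dWP _ ltr01.
have M1 : 0 < M + 1 by rewrite ltr_wpDl.
have [h2 h20 H2] := (proj1 (is_derive_normP _ _ _)) dV _
  (divr_gt0 (divr_gt0 e0 (ltr0n _ 2)) M1).
have [h3 h30 H3] := xZ _ (divr_gt0 (divr_gt0 e0 (ltr0n _ 2)) C0).
exists (Num.min (Num.min h1 h2) (Num.min h3 (Num.min t (T - t)))).
  by rewrite !lt_min h10 h20 h30 t0 subr_gt0.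
move=> s; rewrite !lt_min => /andP[/andP[s1 s2] /andP[s3 /andP[s4 s5]]].
have sT : 0 <= s <= T.
  by move: s4 s5; rewrite !ltr_norml => /andP[? ?] /andP[? ?]; lra.
have /andP[s0 sT1] := sT.
set a := truncated_field rho f g t (x t).
(* The expansion of the Euler limit may be based at any point of the interval, here at [t] as its
   right or its left end. *)
have step1 : `|x s - x t - a (Z s - Z t)| <= e / 2 / C * `|w s - w t|.
  have [st|/ltW ts] := leP s t.
    have := H3 s t t s0 st (lexx t) (ltW tT).
    rewrite -(ger0_norm (x := t - s)) ?subr_ge0// distrC => /(_ s3) H.
    have -> : x s - x t - a (Z s - Z t) = - (x t - x s - a (Z t - Z s)).
      rewrite [LHS]/= -[in LHS](opprB (Z t)) /a /truncated_field /=.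
      rewrite !linearN /= scaleNr -opprD opprK.
      by rewrite !opprD !opprK addrAC [LHS]addrC addrA.
    rewrite normrN; apply: le_trans H _; rewrite distrC ler_wpM2l ?ler_norm//.
    by rewrite !divr_ge0// ltW.
  have := H3 t s t (ltW t0) (lexx t) ts sT1.
  rewrite -(ger0_norm (x := s - t)) ?subr_ge0// => /(_ s3) H.
  apply: le_trans H _; rewrite ler_wpM2l ?ler_norm//.
  by rewrite !divr_ge0// ltW.
have step2 : `|w s - w t| <= C * `|s - t|.
  rewrite /w opprD addrACA; apply: le_trans (ler_normD _ _) _.
  rewrite -(subrK ((s - t) * dW') (W s - W t)).
  have := ler_normD (W s - W t - (s - t) * dW') ((s - t) * dW').
  have := H1 _ s1; rewrite normrM mul1r /C => h h'.
  move: h h'; move: (`|_ - _ - _|) (`|_ + _|) (`|s - t|) => p q r; lra.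
(* By linearity the error of replacing [Z s - Z t] by [(s - t) * (1, u t)] is the field applied to
   the remainder in the derivative of [V]. *)
have step3 : a (Z s - Z t) - (s - t) *: (f t (retract rho (x t))
    + g t (retract rho (x t)) (u t)) = a (0, V s - V t - (s - t) *: u t).
  rewrite /a /truncated_field /= scale0r add0r.
  have -> (A : 'End(E)) v w' : A (v - (s - t) *: w') = A v - (s - t) *: A w'.
    by rewrite linearB linearZ.
  by rewrite scalerDr opprD addrACA subrr add0r.
rewrite -(subrK (a (Z s - Z t)) (x s - x t)) -addrA step3.
apply: le_trans (ler_normD _ _) _; rewrite (splitr e) mulrDl; apply: lerD.
  apply: le_trans step1 _; rewrite -mulrA ler_wpM2l ?divr_ge0 ?(ltW e0)//.
  by rewrite mulrC ler_pdivrMr// mulrC.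
have tT01 : 0 <= t <= T by rewrite !ltW.
apply: le_trans (aM _ _ _ tT01) _.
have -> : `|(0 : R, V s - V t - (s - t) *: u t)| = `|V s - V t - (s - t) *: u t|.
  by rewrite prod_normE /= normr0 max_r.
apply: le_trans (ler_wpM2l M0 (H2 _ s2)) _.
rewrite mulrA ler_wpM2r// mulrCA ler_piMr ?divr_ge0 ?(ltW e0)//.
by rewrite ler_pdivrMr// mul1r lerDl.
Qed.

Lemma global_solution_exists : exists x, solution f g T xi x u.
Proof.
have [x [acx x0 dx]] := truncated_solution_exists.
suff xrho t : 0 <= t <= T -> `|x t| <= rho.
  exists x; split => //; move: dx; apply: filterS.
    exact: (ae_filter_ringOfSetsType leb).
  move=> t + tT => /(_ tT); rewrite retract_id//; apply: xrho.
  by move: tT; rewrite in_itv.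
move=> tT; rewrite leNgt; apply/negP => xt.
pose H := [set s : R | 0 <= s <= T /\ rho <= `|x s|].
have H0 : H !=set0 by exists t; split => //; exact: ltW.
have lbH : has_lbound H by exists 0 => s [/andP[]].
have iH : has_inf H by [].
pose T1 := inf H.
have T10 : 0 <= T1 by apply: lb_le_inf => // s [/andP[]].
have T1T : T1 <= T.
  have /andP[_] := tT; apply: le_trans; apply: ge_inf => //.
  by split => //; exact: ltW.
have T1_itv : 0 <= T1 <= T by rewrite T10.
have before s : 0 <= s -> s < T1 -> `|x s| < rho.
  move=> s0 sT1; rewrite ltNge; apply/negP => rs.
  have : T1 <= s.
    by apply: ge_inf => //; split => //; rewrite s0 (le_trans (ltW sT1)).
  by rewrite leNgt sT1.
(* [T1] is the first exit time from the open ball. *)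
have xT1 : rho <= `|x T1|.
  rewrite leNgt; apply/negP => lt.
  have gap : 0 < rho - `|x T1| by rewrite subr_gt0.
  have [h h0 xh] := absolutely_continuous_uniform acx gap.
  have [s [sT rs] sh] := inf_adherent h0 iH.
  have T1s : T1 <= s by apply: ge_inf.
  have := xh s T1 sT T1_itv; rewrite ger0_norm ?subr_ge0// ltrBlDl => /(_ sh).
  move=> /(le_lt_trans (lerB_dist _ _)); rewrite ltrD2r.
  by rewrite ltNge rs.
have xi_rho : `|xi| < rho.
  by rewrite /rho (@le_lt_trans _ _ (Num.max B `|xi|)) ?ltrDl// le_max lexx orbT.
have T1_gt0 : 0 < T1.
  rewrite lt_neqAle T10 andbT; apply/eqP => T10'.
  by move: xT1; rewrite -T10' x0 leNgt xi_rho.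
(* Before [T1] the retraction is the identity along [x], so [x] solves the original equation up to
   [T1]. *)
have sol : solution f g T1 xi x u.
  split => //.
    move=> e e0; have [d d0 xd] := acx _ e0; exists d => // n c c' cc'.
    apply: xd => i; have [? [? c'T]] := cc' i; split => //; split => //.
    exact: le_trans T1T.
  have ne : {ae leb, forall t : R, t != T1}.
    apply: ae_lebesgue_completed; exists [set T1]; split => //.
      exact: lebesgue_measure_set1.
    by move=> s /= /negP; rewrite negbK => /eqP.
  move: dx ne; apply: filterS2; first exact: (ae_filter_ringOfSetsType leb).
  move=> s ds sT1; rewrite in_itv /= => /andP[s0 s1].
  have sT : s \in `[0, T] by rewrite in_itv /= s0 (le_trans s1).
  have := ds sT; rewrite retract_id//; apply/ltW/before => //.
  by rewrite lt_neqAle sT1.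
have := a_priori T1_gt0 T1T sol (t := T1); rewrite T10 lexx => /(_ isT) xB.
have : rho <= B by exact: le_trans xB.
rewrite leNgt => /negP; apply.
by rewrite (@le_lt_trans _ _ (Num.max B `|xi|)) ?ltrDl// le_max lexx.
Qed.

End global_solution.

(** * Young integration *)

Section halving.
Context {R : realType}.

(** [k] is the last index below [j] at which at most half of the increment is used up. The cell from
    [k] to [k.+1], where [m] may jump, belongs to neither half. *)
Lemma half_split (m : nat -> R) (i j : nat) : (i < j)%N ->
  (forall k l, (i <= k)%N -> (k <= l)%N -> (l <= j)%N -> m k <= m l) ->
  exists k, [/\ (i <= k < j)%N, m k - m i <= (m j - m i) / 2 &
    m j - m k.+1 <= (m j - m i) / 2].
Proof.
move=> ij mono; have mij : m i <= m j by apply: mono => //; exact: ltnW.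
pose P k := (i <= k < j)%N && (m k - m i <= (m j - m i) / 2).
have exP : exists k, P k.
  by exists i; rewrite /P leqnn ij subrr divr_ge0// subr_ge0.
have ubP k : P k -> (k <= j)%N by move=> /andP[/andP[_ /ltnW]].
case: (ex_maxnP exP ubP) => k /andP[/andP[ik kj] mk] kmax.
exists k; split => //; first by rewrite ik.
have [kj1|kj1] := ltnP k.+1 j; last first.
  have -> : k.+1 = j by apply/eqP; rewrite eqn_leq kj.
  by rewrite subrr divr_ge0// subr_ge0.
have : ~~ P k.+1 by apply/negP => /kmax; rewrite ltnn.
rewrite /P kj1 (leq_trans ik)//= -ltNge => ?; lra.
Qed.

End halving.

Section discrete_young.
Context {R : realType} (Y : normedModType R).
Variables (phi : nat -> Y -> R) (eta : nat -> Y) (m : nat -> R) (eps a b C : R).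
Variables (i0 j0 : nat).
Hypotheses (phi_add : forall k, {morph phi k : y z / y + z}) (eps_ge0 : 0 <= eps)
  (a_ge0 : 0 <= a) (b_ge0 : 0 <= b) (ab_gt1 : 1 < a + b)
  (C_ge0 : 0 <= C) (C_ge : 2 * (C * 2^-1 `^ (a + b)) + 2 <= C)
  (m_mono : forall k l, (i0 <= k)%N -> (k <= l)%N -> (l <= j0)%N -> m k <= m l)
  (eta_le : forall k l, (i0 <= k)%N -> (k <= l)%N -> (l <= j0)%N ->
     `|eta l - eta k| <= (m l - m k) `^ b)
  (phi_le : forall k l y, (i0 <= k)%N -> (k <= l)%N -> (l <= j0)%N ->
     `|phi l y - phi k y| <= eps * (m l - m k) `^ a * `|y|).

Let rs i j := \sum_(i <= k < j) phi k (eta k.+1 - eta k).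

Let phi0 k : phi k 0 = 0.
Proof. by apply: (addrI (phi k 0)); rewrite -phi_add !addr0. Qed.

(* Split where the control [m] is halved: both halves carry the factor
   [2^-(a+b)], and [2 * 2^-(a+b) < 1]. *)
Lemma discrete_young i j : (i0 <= i)%N -> (i <= j)%N -> (j <= j0)%N ->
  `|rs i j - phi i (eta j - eta i)| <= C * (eps * (m j - m i) `^ (a + b)).
Proof.
have [n] := ubnP (j - i); elim: n i j => // n IH i j + i0i ij jj0.
rewrite ltnS => jin; move: ij; rewrite leq_eqVlt => /predU1P[->|ij].
  rewrite /rs big_geq// subrr phi0 subrr normr0.
  by rewrite !mulr_ge0// powR_ge0.
have [|k [/andP[ik kj] mk mk1]] := half_split (m := m) ij.
  move=> k l ik kl lj; apply: m_mono => //; first exact: leq_trans ik.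
  exact: leq_trans lj jj0.
have i0k := leq_trans i0i ik; have k1j0 := leq_trans kj jj0.
have kj0 := ltnW k1j0; have i0k1 := leqW i0k.
have IH1 : `|rs i k - phi i (eta k - eta i)| <= C * (eps * (m k - m i) `^ (a + b)).
  apply: IH => //; apply: leq_trans jin; exact: ltn_sub2r.
have IH2 : `|rs k.+1 j - phi k.+1 (eta j - eta k.+1)| <=
    C * (eps * (m j - m k.+1) `^ (a + b)).
  apply: IH => //; apply: leq_trans jin.
  by apply: ltn_sub2l => //; rewrite ltnS.
set mu := m j - m i in mk mk1 *.
have mij : m i <= m k by exact: m_mono.
have mkk : m k <= m k.+1 by exact: m_mono.
have mkj : m k.+1 <= m j by exact: m_mono.
have mu0 : 0 <= mu by rewrite /mu; lra.
have powle x c : 0 <= c -> 0 <= x -> x <= mu -> x `^ c <= mu `^ c.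
  by move=> c0 x0 xm; apply: ge0_ler_powR => //; rewrite nnegrE.
have half x : 0 <= x -> x <= mu / 2 ->
    C * (eps * x `^ (a + b)) <= C * 2^-1 `^ (a + b) * (eps * mu `^ (a + b)).
  move=> x0 xm; rewrite -mulrA ler_wpM2l// mulrCA ler_wpM2l//.
  rewrite mulrC -powRM ?invr_ge0//; apply: ge0_ler_powR.
  - by rewrite addr_ge0.
  - by rewrite nnegrE.
  - by rewrite nnegrE divr_ge0.
  - exact: xm.
have cross x y (v : Y) : 0 <= x -> x <= mu -> 0 <= y -> y <= mu -> `|v| <= y `^ b ->
    eps * x `^ a * `|v| <= eps * mu `^ (a + b).
  move=> x0 xm y0 ym vb; rewrite -mulrA ler_wpM2l// powRD; last first.
    by apply/implyP => /eqP ab0; move: ab_gt1; rewrite ab0 ltr10.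
  apply: ler_pM => //; [exact: powR_ge0|exact: powle|].
  by apply: le_trans vb _; exact: powle.
(* The middle cell and the right part are rebased to the functional at [i]. Each change costs at
   most [eps * mu ^ (a + b)]; these two are the summand 2 in [C_ge]. *)
have -> : rs i j - phi i (eta j - eta i) =
    (rs i k - phi i (eta k - eta i)) + (rs k.+1 j - phi k.+1 (eta j - eta k.+1))
    + ((phi k (eta k.+1 - eta k) - phi i (eta k.+1 - eta k))
    + (phi k.+1 (eta j - eta k.+1) - phi i (eta j - eta k.+1))).
  have -> : rs i j = rs i k + (phi k (eta k.+1 - eta k) + rs k.+1 j).
    by rewrite /rs (big_cat_nat ik (ltnW kj)) (big_ltn kj).
  have -> : eta j - eta i =
      (eta k - eta i) + ((eta k.+1 - eta k) + (eta j - eta k.+1)).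
    have tele (p q r : Y) : (q - p) + (r - q) = r - p by rewrite addrC addrA subrK.
    by rewrite !tele.
  rewrite !phi_add; lra.
have h1 := half _ (_ : 0 <= m k - m i) mk.
have h2 := half _ (_ : 0 <= m j - m k.+1) mk1.
have {}h1 := h1 (eqbRL (subr_ge0 _ _) mij).
have {}h2 := h2 (eqbRL (subr_ge0 _ _) mkj).
have h3 : `|phi k (eta k.+1 - eta k) - phi i (eta k.+1 - eta k)| <=
    eps * mu `^ (a + b).
  apply: le_trans (phi_le _ i0i ik kj0) _.
  by apply: (cross _ (m k.+1 - m k)); rewrite ?eta_le//; rewrite /mu; lra.
have h4 : `|phi k.+1 (eta j - eta k.+1) - phi i (eta j - eta k.+1)| <=
    eps * mu `^ (a + b).
  apply: le_trans (phi_le _ i0i (leqW ik) k1j0) _.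
  by apply: (cross _ (m j - m k.+1)); rewrite ?eta_le//; rewrite /mu; lra.
apply: le_trans (ler_normD _ _) _.
apply: le_trans (lerD (ler_normD _ _) (ler_normD _ _)) _.
have : (2 * (C * 2^-1 `^ (a + b)) + 2) * (eps * mu `^ (a + b)) <=
    C * (eps * mu `^ (a + b)).
  by rewrite ler_wpM2r// mulr_ge0// powR_ge0.
have := le_trans IH1 h1; have := le_trans IH2 h2.
move: h3 h4; move: (`|_|) (`|_|) (`|_|) (`|_|) => p q s t.
move: (eps * _) (2^-1 `^ _) => M c; lra.
Qed.

End discrete_young.

(** The [C] chosen gives equality; the denominator is positive because [1 < c]. *)
Lemma discrete_young_constant (R : realType) (c : R) : 1 < c ->
  exists2 C, 0 <= C & 2 * (C * 2^-1 `^ c) + 2 <= C.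
Proof.
move=> c1; have h : 2^-1 `^ c < 2^-1 :> R.
  rewrite -[c](subrK 1) powRD; last by rewrite invr_eq0 pnatr_eq0 implybT.
  rewrite powRr1 ?invr_ge0// gtr_pMl ?invr_gt0//.
  apply: (@lt_le_trans _ _ (1 `^ (c - 1))); last by rewrite powR1.
  by apply: gt0_ltr_powR; rewrite ?nnegrE ?invr_ge0// ?subr_gt0// invf_lt1// ltr1n.
have d0 : 0 < 1 - 2 * 2^-1 `^ c by lra.
exists (2 / (1 - 2 * 2^-1 `^ c)); first by rewrite divr_ge0// ltW.
rewrite -subr_ge0 (_ : _ - _ = 0)//; field.
by rewrite gt_eqF.
Qed.

Section young_integral.
Context {R : realType} (Y : normedModType R).
Variables (T : R) (phi : R -> Y -> R) (eta : R -> Y) (m : R -> R) (a b K : R).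
Hypotheses (T_gt0 : 0 < T) (phi_add : forall t, {morph phi t : y z / y + z})
  (a_ge0 : 0 <= a) (b_ge0 : 0 <= b) (ab_gt1 : 1 < a + b) (K_ge0 : 0 <= K)
  (m_mono : forall s t, 0 <= s -> s <= t -> t <= T -> m s <= m t)
  (eta_le : forall s t, 0 <= s -> s <= t -> t <= T ->
     `|eta t - eta s| <= (m t - m s) `^ b)
  (eta_unif : forall e, 0 < e -> exists2 h, 0 < h & forall s t,
     0 <= s <= T -> 0 <= t <= T -> `|s - t| < h -> `|eta s - eta t| < e)
  (phi_le : forall e, 0 < e -> exists2 h, 0 < h & forall s t y,
     0 <= s -> s <= t -> t <= T -> t - s < h ->
     `|phi t y - phi s y| <= e * (m t - m s) `^ a * `|y|)
  (phi_bound : forall t y, 0 <= t <= T -> `|phi t y| <= K * `|y|).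

Let M := m T - m 0.

Let M_ge0 : 0 <= M.
Proof. by rewrite subr_ge0; apply: m_mono => //; exact: ltW. Qed.

Let phiB t : {morph phi t : y z / y - z}.
Proof. by move=> y z; apply: (addIr (phi t z)); rewrite -phi_add !subrK. Qed.

(** The reference sums, tagged at left ends; the integral will be their ultralimit. *)
Let J n := \sum_(0 <= k < n.+1) phi (grid T n k) (eta (grid T n k.+1) - eta (grid T n k)).

Let m_diff s t : 0 <= s -> s <= t -> t <= T -> 0 <= m t - m s <= M.
Proof.
move=> s0 st tT; rewrite subr_ge0 m_mono//= /M lerB// m_mono//.
  exact: le_trans st.
exact: le_trans tT.
Qed.

(** As [a + b] exceeds 1, the power is dominated by a linear term, and linear terms telescope over a
    partition. *)
Let powR_le_linear x : 0 <= x <= M -> x `^ (a + b) <= M `^ (a + b - 1) * x.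
Proof.
move=> /andP[x0 xM]; have -> : x `^ (a + b) = x `^ (a + b - 1) * x.
  rewrite -[X in _ * X](powRr1 x0) -powRD; first by rewrite subrK.
  by rewrite subrK gt_eqF// (lt_trans _ ab_gt1).
rewrite ler_wpM2r//; apply: ge0_ler_powR => //.
by rewrite subr_ge0 ltW.
Qed.

Lemma big_nat_blocks (F : nat -> R) (p : nat -> nat) N :
  (forall k, (k < N)%N -> (p k <= p k.+1)%N) ->
  \sum_(0 <= k < N) \sum_(p k <= l < p k.+1) F l = \sum_(p 0%N <= l < p N) F l.
Proof.
elim: N => [|N IH] pm; first by rewrite !big_geq.
have p0N : (p 0%N <= p N)%N.
  elim: N pm {IH} => // N IHN pm; apply: leq_trans (pm N _) => //.
  by apply: IHN => k kN; apply: pm; exact: leqW.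
rewrite big_nat_recr//= IH => [|k kN]; last by apply: pm; exact: leqW.
by rewrite -big_cat_nat//; exact: pm.
Qed.

Variable C : R.
Hypotheses (C_ge0 : 0 <= C) (C_ge : 2 * (C * 2^-1 `^ (a + b)) + 2 <= C).

Section partition.
Variables (N : nat) (t : nat -> R).
Hypotheses (t_first : t 0%N = 0) (t_last : t N = T)
  (t_mono : forall k, (k < N)%N -> t k <= t k.+1).

Let t_le k l : (k <= l)%N -> (l <= N)%N -> t k <= t l.
Proof.
elim: l => [|l IH]; first by rewrite leqn0 => /eqP ->.
rewrite leq_eqVlt => /predU1P[->//|]; rewrite ltnS => kl lN.
by apply: le_trans (t_mono lN); apply: IH => //; exact: ltnW.
Qed.

Let t_itv k : (k <= N)%N -> 0 <= t k <= T.
Proof.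
by move=> kN; rewrite -{1}t_first -t_last t_le//= t_le.
Qed.

Let g n k := grid T n (grid_floor T n (t k)).

Let g_itv n k : (k <= N)%N -> 0 <= g n k <= T.
Proof.
by move=> /t_itv /andP[_ tT]; apply: grid_itv => //; exact: grid_floor_bound.
Qed.

Let g_le n k : (k < N)%N -> g n k <= g n k.+1.
Proof.
by move=> kN; apply: ler_grid => //; apply: le_grid_floor => //; exact: t_mono.
Qed.

(* [g n k] is the point of the [n]-th grid just below [t k]. *)
Lemma grid_sum_near_partition_sum n e h : 0 <= e ->
  (forall s t y, 0 <= s -> s <= t -> t <= T -> t - s < h ->
     `|phi t y - phi s y| <= e * (m t - m s) `^ a * `|y|) ->
  (forall k, (k < N)%N -> t k.+1 - t k < h / 2) ->
  T / n.+1%:R + T / n.+1%:R < h / 2 ->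
  `|J n - \sum_(0 <= k < N) phi (g n k) (eta (g n k.+1) - eta (g n k))| <=
  C * (e * (M `^ (a + b - 1) * M)).
Proof.
move=> e0 phi_h t_h n_h; pose p k := grid_floor T n (t k).
have pm k : (k < N)%N -> (p k <= p k.+1)%N.
  by move=> kN; apply: le_grid_floor => //; exact: t_mono.
have -> : J n = \sum_(0 <= k < N) \sum_(p k <= l < p k.+1)
    phi (grid T n l) (eta (grid T n l.+1) - eta (grid T n l)).
  by rewrite big_nat_blocks// /p t_first t_last grid_floor0 grid_floor_last.
rewrite -sumrB; apply: le_trans (ler_norm_sum _ _ _) _.
apply: (@le_trans _ _ (\sum_(0 <= k < N)
    C * (e * (M `^ (a + b - 1) * (m (g n k.+1) - m (g n k)))))).
  apply: ler_sum_nat => k /andP[_ kN].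
  have /andP[gk0 _] := g_itv n (ltnW kN); have /andP[_ gkT] := g_itv n kN.
  have gk := g_le n kN.
  apply: le_trans (_ : _ <= C * (e * (m (g n k.+1) - m (g n k)) `^ (a + b))) _.
    have grid_in l : (p k <= l)%N -> (l <= p k.+1)%N ->
        0 <= grid T n l /\ grid T n l <= T.
      move=> kl lk; split; first by apply: le_trans gk0 _; exact: ler_grid.
      by apply: le_trans gkT; exact: ler_grid.
    (* The grid cells between the roundings of [t k] and [t k.+1] form one block, compared with a
       single term. *)
    apply: (@discrete_young _ _ (fun l => phi (grid T n l))
      (fun l => eta (grid T n l)) (fun l => m (grid T n l))
      e a b C (p k) (p k.+1)) => //.
    - by move=> l l' kl ll' lk; apply: m_mono; [
        have [] := grid_in l kl (leq_trans ll' lk)|exact: ler_grid|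
        have [] := grid_in l' (leq_trans kl ll') lk].
    - by move=> l l' kl ll' lk; apply: eta_le; [
        have [] := grid_in l kl (leq_trans ll' lk)|exact: ler_grid|
        have [] := grid_in l' (leq_trans kl ll') lk].
    - move=> l l' y kl ll' lk; apply: phi_h.
      + by have [] := grid_in l kl (leq_trans ll' lk).
      + exact: ler_grid.
      + by have [] := grid_in l' (leq_trans kl ll') lk.
      (* A block is shorter than [h]: [h / 2] for the cell of the partition and [h / 2] for rounding
         its left end. *)
      have h1 := ler_grid T_gt0 n kl; have h2 := ler_grid T_gt0 n lk.
      have /andP[tk1 _] := t_itv kN; have /andP[tk0 _] := t_itv (ltnW kN).
      have h3 := grid_floor_le T_gt0 n tk1; have h4 := grid_floor_dist T_gt0 n tk0.
      have h5 := t_h k kN; rewrite -/(p k) -/(p k.+1) in h3 h4.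
      move: n_h h4; move: (T / n.+1%:R + T / n.+1%:R) => q qh.
      rewrite ltr_norml => /andP[h4 _].
      move: h1 h2 h3 h4 h5; move: (grid T n _) (grid T n _) (grid T n _) (grid T n _).
      by move=> x1 x2 x3 x4; lra.
    - exact: pm.
  rewrite ler_wpM2l// ler_wpM2l//; apply: powR_le_linear.
  exact: m_diff.
rewrite -!mulr_sumr telescope_sumr// /g t_first t_last grid_floor0.
rewrite (grid_floor_last T_gt0).
by rewrite grid0 grid_last//.
Qed.

(** Moving a tag within its cell costs [e] times the power [a + b] of the increment of [m], and
    these costs add up by [powR_le_linear]. *)
Lemma tagged_sum_near_partition_sum (tau : nat -> R) e h : 0 <= e ->
  (forall s t y, 0 <= s -> s <= t -> t <= T -> t - s < h ->
     `|phi t y - phi s y| <= e * (m t - m s) `^ a * `|y|) ->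
  (forall k, (k < N)%N -> t k.+1 - t k < h) ->
  (forall k, (k < N)%N -> t k <= tau k <= t k.+1) ->
  `|\sum_(0 <= k < N) phi (tau k) (eta (t k.+1) - eta (t k))
    - \sum_(0 <= k < N) phi (t k) (eta (t k.+1) - eta (t k))| <=
  e * (M `^ (a + b - 1) * M).
Proof.
move=> e0 phi_h t_h tau_itv.
rewrite -sumrB; apply: le_trans (ler_norm_sum _ _ _) _.
apply: (@le_trans _ _ (\sum_(0 <= k < N)
    e * (M `^ (a + b - 1) * (m (t k.+1) - m (t k))))).
  apply: ler_sum_nat => k /andP[_ kN].
  have /andP[tk0 _] := t_itv (ltnW kN); have /andP[_ tkT] := t_itv kN.
  have tk := t_mono kN; have /andP[tk1 tk2] := tau_itv k kN.
  have md := m_diff tk0 tk tkT; have /andP[md0 mdM] := md.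
  apply: (@le_trans _ _ (e * (m (t k.+1) - m (t k)) `^ (a + b))); last first.
    by rewrite ler_wpM2l//; exact: powR_le_linear.
  apply: le_trans (phi_h _ _ _ tk0 tk1 (le_trans tk2 tkT) _) _.
    by apply: le_lt_trans (t_h k kN); rewrite lerB.
  rewrite powRD; last by rewrite gt_eqF// (lt_trans _ ab_gt1).
  rewrite -mulrA ler_wpM2l//; apply: ler_pM => //; first exact: powR_ge0.
    apply: ge0_ler_powR => //; rewrite ?nnegrE//.
      by rewrite subr_ge0 m_mono// (le_trans tk2).
    by rewrite lerB// m_mono// (le_trans tk0).
  exact: eta_le.
rewrite -!mulr_sumr telescope_sumr// t_first t_last.
by [].
Qed.

(** The partition is fixed while the grid is refined, so finitely many terms have to converge. As
    [m] may jump, [eta_le] does not make the change of [eta] small; this is the task of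
    [eta_unif]. *)
Lemma partition_sum_ultra G e : UltraFilter G -> \oo `<=` G -> 0 < e ->
  G [set n | `|\sum_(0 <= k < N) phi (g n k) (eta (g n k.+1) - eta (g n k))
    - \sum_(0 <= k < N) phi (t k) (eta (t k.+1) - eta (t k))| < e].
Proof.
move=> UG Goo e0.
have gt k d : (k <= N)%N -> 0 < d -> G [set n | `|g n k - t k| < d].
  by move=> kN d0; have /andP[tk0 _] := t_itv kN; apply: ultra_grid_floor.
have eta_g k d : (k <= N)%N -> 0 < d -> G [set n | `|eta (g n k) - eta (t k)| < d].
  move=> kN d0; have [h h0 eta_h] := eta_unif d0.
  apply: filterS (gt k h kN h0) => n /= nh.
  by apply: eta_h => //; [exact: g_itv|exact: t_itv].
have term k d : (k < N)%N -> 0 < d -> G [set n |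
    `|phi (g n k) (eta (g n k.+1) - eta (g n k))
      - phi (t k) (eta (t k.+1) - eta (t k))| < d].
  (* Half of [d] is for the change of time in [phi], with increments of [m] bounded by [M], and half
     for the two ends of the increment of [eta]. The added 1 keeps the divisors positive. *)
  move=> kN d0; pose Q := M `^ a * M `^ b + 1.
  have Q0 : 0 < Q by rewrite ltr_wpDl// mulr_ge0// powR_ge0.
  have [h h0 phi_h] := phi_le (divr_gt0 (divr_gt0 d0 (ltr0n _ 2)) Q0).
  have K1 : 0 < 4 * (K + 1) by rewrite mulr_gt0// ltr_wpDl.
  have d1 := divr_gt0 d0 K1.
  apply: filterS (filterI (gt k h (ltnW kN) h0)
    (filterI (eta_g k _ (ltnW kN) d1) (eta_g k.+1 _ kN d1))) => n /= [gh [ek ek1]].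
  have /andP[tk0 tkT] := t_itv (ltnW kN).
  have /andP[gk0 gkT] := g_itv n (ltnW kN); have /andP[_ gk1T] := g_itv n kN.
  have gk := g_le n kN.
  have gtk : g n k <= t k by exact: grid_floor_le.
  set y := eta (g n k.+1) - eta (g n k).
  rewrite -(subrK (phi (t k) y) (phi (g n k) y)) -addrA.
  apply: le_lt_trans (ler_normD _ _) _.
  rewrite (splitr d); apply: ler_ltD.
    rewrite distrC; apply: le_trans (phi_h _ _ _ gk0 gtk tkT _) _.
      by rewrite -(ger0_norm (x := t k - g n k)) ?subr_ge0// distrC.
    have /andP[md0 mdM] := m_diff gk0 gtk tkT.
    have /andP[md0' mdM'] := m_diff gk0 gk gk1T.
    apply: (@le_trans _ _ (d / 2 / Q * (M `^ a * M `^ b))).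
      rewrite -mulrA ler_wpM2l//; first by rewrite !divr_ge0// ltW.
      apply: ler_pM => //; first exact: powR_ge0.
        by apply: ge0_ler_powR; rewrite ?nnegrE.
      apply: le_trans (eta_le gk0 gk gk1T) _.
      by apply: ge0_ler_powR; rewrite ?nnegrE.
    rewrite mulrAC ler_pdivrMr// ler_wpM2l ?divr_ge0 ?(ltW d0)//.
    by rewrite /Q lerDl.
  rewrite -phiB; apply: le_lt_trans (phi_bound _ _) _; first by rewrite tk0.
  have -> : y - (eta (t k.+1) - eta (t k)) =
      (eta (g n k.+1) - eta (t k.+1)) - (eta (g n k) - eta (t k)).
    by rewrite /y !opprB addrACA [X in _ + X]addrC [in RHS]addrACA.
  apply: le_lt_trans (ler_wpM2l K_ge0 (ler_normB _ _)) _.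
  apply: (@le_lt_trans _ _ (K * (d / (4 * (K + 1)) + d / (4 * (K + 1))))).
    by rewrite ler_wpM2l// lerD// ltW.
  have -> : K * (d / (4 * (K + 1)) + d / (4 * (K + 1))) = K / (K + 1) * (d / 2).
    by field; rewrite gt_eqF// ltr_wpDl.
  have Kp : 0 < K + 1 by rewrite ltr_wpDl.
  by rewrite gtr_pMl ?divr_gt0// ltr_pdivrMr// mul1r ltrDl.
suff H j d : (j <= N)%N -> 0 < d -> G [set n |
    `|\sum_(0 <= k < j) phi (g n k) (eta (g n k.+1) - eta (g n k))
    - \sum_(0 <= k < j) phi (t k) (eta (t k.+1) - eta (t k))| < d].
  exact: H.
elim: j d => [|j IH] d jN d0.
  by apply: filterE => n /=; rewrite !big_geq// subrr normr0.
have d2 : 0 < d / 2 by rewrite divr_gt0.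
apply: filterS (filterI (IH _ (ltnW jN) d2) (term j _ jN d2)) => n /= [n1 n2].
rewrite !big_nat_recr//= opprD addrACA (splitr d).
by apply: le_lt_trans (ler_normD _ _) _; exact: ltrD.
Qed.

End partition.

(** A fine sum [S1] is compared with the sum [S2] tagged at left ends, this with the sum [S3] over
    rounded points, and this with [J n]. The mesh depends on [e] only; [n] may depend on the
    partition, since [S] is the limit of [J]. *)
Lemma riemann_sums_converge : exists S, forall e, 0 < e -> exists2 h, 0 < h &
  forall N (t tau : nat -> R), t 0%N = 0 -> t N = T ->
    (forall k, (k < N)%N -> t k <= t k.+1) ->
    (forall k, (k < N)%N -> t k.+1 - t k < h) ->
    (forall k, (k < N)%N -> t k <= tau k <= t k.+1) ->
    `|\sum_(0 <= k < N) phi (tau k) (eta (t k.+1) - eta (t k)) - S| < e.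
Proof.
have [G [UG Goo]] := ultrafilter_nat.
pose Q := M `^ (a + b - 1) * M.
have Q0 : 0 <= Q by rewrite mulr_ge0// powR_ge0.
have [S JS] : exists S : R^o, (J : nat -> R^o) @ G --> S.
  have [h h0 phi_h] := phi_le ltr01.
  have h2 : 0 < h / 2 by rewrite divr_gt0.
  have [n0 n0h] : exists n0, T / n0.+1%:R < h / 2.
    exact: filter_ex (ultra_inv_lt Goo T h2).
  (* [J] is bounded by comparison with one coarse grid [n0], each of whose [n0.+1] terms is at most
     [K * M ^ b]. *)
  pose B : R := C * Q + \sum_(0 <= k < n0.+1) K * M `^ b.
  have [S _ JS] : exists2 S : R^o, `[(- B), B]%classic S & (J : nat -> R^o) @ G --> S.
    apply: ultra_compact_cvg; first exact: segment_compact.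
    apply: filterS (ultra_inv_lt Goo (T + T) h2) => n /=; rewrite mulrDl => nh.
    rewrite in_itv /= -ler_norml.
    have gmono k : (k < n0.+1)%N -> grid T n0 k <= grid T n0 k.+1.
      by move=> _; exact: ler_grid.
    have := grid_sum_near_partition_sum (grid0 T n0) (grid_last T n0) gmono
      ler01 phi_h _ nh.
    have gh k : (k < n0.+1)%N -> grid T n0 k.+1 - grid T n0 k < h / 2.
      by move=> _; rewrite gridS addrC addKr.
    move=> /(_ gh); set X := \sum_(_ <= _ < _) _ => JX.
    rewrite -(subrK X (J n)); apply: le_trans (ler_normD _ _) _; apply: lerD.
      by apply: le_trans JX _; rewrite mul1r.
    apply: le_trans (ler_norm_sum _ _ _) _; apply: ler_sum_nat => k /andP[_ kn].
    have gk_itv l : (l <= n0.+1)%N ->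
        0 <= grid T n (grid_floor T n (grid T n0 l)) <= T.
      move=> ln; apply: grid_itv => //; apply: grid_floor_bound => //.
      by have /andP[] := grid_itv T_gt0 ln.
    have gle : grid T n (grid_floor T n (grid T n0 k)) <=
        grid T n (grid_floor T n (grid T n0 k.+1)).
      by apply: ler_grid => //; apply: le_grid_floor => //; exact: ler_grid.
    have gk := gk_itv k (ltnW kn); have gk1 := gk_itv k.+1 kn.
    apply: le_trans (phi_bound _ gk) _; rewrite ler_wpM2l//.
    have /andP[gk0 _] := gk; have /andP[_ gkT] := gk1.
    apply: le_trans (eta_le gk0 gle gkT) _.
    have /andP[md0 mdM] := m_diff gk0 gle gkT.
    by apply: ge0_ler_powR; rewrite ?nnegrE.
  by exists S.
exists S => e e0.
(* With this divisor the errors of moving the tags and of refining add up to at most [e / 4]. *)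
have C1 : 0 < 4 * ((C + 1) * (Q + 1)).
  by rewrite mulr_gt0// mulr_gt0// ltr_wpDl.
have eps0 := divr_gt0 e0 C1; have [h h0 phi_h] := phi_le eps0.
set eps := e / _ in eps0 phi_h.
have h2 : 0 < h / 2 by rewrite divr_gt0.
have e4 : 0 < e / 4 by rewrite divr_gt0.
exists (h / 2) => // N t tau t0 tN t_mono t_h tau_itv.
have [n [/= nh [nS nP]]] := filter_ex (filterI (ultra_inv_lt Goo (T + T) h2)
  (filterI (@ultra_dist_lt _ _ UG R^o _ _ _ JS e4) (partition_sum_ultra t0 tN t_mono UG Goo e4))).
rewrite /= mulrDl in nh.
have H1 := grid_sum_near_partition_sum t0 tN t_mono (ltW eps0) phi_h t_h nh.
have t_h' k : (k < N)%N -> t k.+1 - t k < h.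
  move=> kN; apply: lt_trans (t_h k kN) _.
  by rewrite ltr_pdivrMr// ltr_pMr// ltr1n.
have H2 := tagged_sum_near_partition_sum t0 tN t_mono (ltW eps0) phi_h t_h' tau_itv.
have H3 : C * (eps * Q) + eps * Q <= e / 4.
  rewrite (_ : _ + _ = (C + 1) * Q * eps); last by ring.
  rewrite /eps [X in X <= _]mulrA ler_pdivrMr//.
  rewrite (_ : e / 4 * _ = e * ((C + 1) * (Q + 1))); last by field.
  rewrite mulrC ler_pM2l// ler_wpM2l//; first by rewrite addr_ge0.
  by rewrite lerDl.
set S1 := \sum_(_ <= _ < _) phi (tau _) _.
pose S2 := \sum_(0 <= k < N) phi (t k) (eta (t k.+1) - eta (t k)).
pose g k := grid T n (grid_floor T n (t k)).
pose S3 := \sum_(0 <= k < N) phi (g k) (eta (g k.+1) - eta (g k)).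
have {}H1 : `|J n - S3| <= C * (eps * Q) := H1.
have {}H2 : `|S1 - S2| <= eps * Q := H2.
have {}nP : `|S3 - S2| < e / 4 := nP.
rewrite (_ : S1 - S = (S1 - S2) - (S3 - S2) - (J n - S3) + (J n - S)); last first.
  by ring.
apply: le_lt_trans (ler_normD _ _) _.
apply: le_lt_trans (_ : _ <= `|S1 - S2| + `|S3 - S2| + `|J n - S3| + `|J n - S|) _.
  rewrite lerD2r; apply: le_trans (ler_normB _ _) _; rewrite lerD2r.
  exact: ler_normB.
move: nS nP H1 H2 H3 => /=.
move=> nS nP H1 H2 H3.
have h12 : `|S1 - S2| + `|J n - S3| <= e / 4.
  by apply: le_trans H3; rewrite addrC; exact: lerD.
have h34 : `|S3 - S2| + `|J n - S| < e / 4 + e / 4 by exact: ltrD.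
have -> : `|S1 - S2| + `|S3 - S2| + `|J n - S3| + `|J n - S| =
    (`|S1 - S2| + `|J n - S3|) + (`|S3 - S2| + `|J n - S|).
  by rewrite -!addrA; congr (_ + _); rewrite addrCA.
apply: lt_trans (ler_ltD h12 h34) _.
by lra.
Qed.

End young_integral.

(** * Controls of finite variation *)

Section variation_control.
Context {R : realType}.

Lemma itv_partition_points (a b : R) (s : seq R) : itv_partition a b s ->
  nth b (a :: s) (size s) = b /\
  forall k, (k < size s)%N -> nth b (a :: s) k < nth b (a :: s) k.+1.
Proof.
move=> [/pathP pth /eqP lst]; split; last by move=> k /pth; apply.
by rewrite -[in RHS]lst (last_nth b).
Qed.

Variables (T C : R) (q : R -> R -> R).
Hypotheses (q_ge0 : forall s t, 0 <= q s t) (q_refl : forall s, q s s = 0)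
  (q_sum : forall s, itv_partition 0 T s ->
     \sum_(0 <= i < size s) q (nth T (0 :: s) i) (nth T (0 :: s) i.+1) <= C).

Let sums t := [set \sum_(0 <= i < size s) q (nth t (0 :: s) i) (nth t (0 :: s) i.+1)
  | s in itv_partition 0 t].

Let sums_extend s t y : s < t -> sums s y -> sums t (y + q s t).
Proof.
move=> st [p [pth /eqP lst] <-]; exists (rcons p t).
  by split; rewrite ?rcons_path ?last_rcons// pth lst.
rewrite size_rcons big_nat_recr//=.
(* The default of [nth] is the end point and so differs between the two lists; at index [size p] it
   is the last point that has to agree. *)
have nth_p i : (i <= size p)%N -> nth t (0 :: rcons p t) i = nth s (0 :: p) i.
  case: i => // i ip; rewrite /= nth_rcons ip.
  exact: set_nth_default.
congr (_ + _).
  apply: eq_big_nat => i /andP[_ ip]; congr q.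
    exact: nth_p (ltnW ip).
  exact: (nth_p i.+1 ip).
congr q; first by rewrite nth_p// -[in RHS]lst (last_nth s).
by rewrite nth_rcons ltnn eqxx.
Qed.

Let sums_nonempty t : 0 <= t -> sums t !=set0.
Proof.
rewrite le_eqVlt => /predU1P[<-|t0].
  by exists 0, [::]; [split|rewrite big_geq].
by eexists; exists [:: t] => //; split; rewrite /= ?t0 ?eqxx.
Qed.

Let sums_bounded t : t <= T -> has_ubound (sums t).
Proof.
rewrite le_eqVlt => /predU1P[->|tT].
  by exists C => _ [s sp <-]; exact: q_sum.
exists C => y /(sums_extend tT)[s sp yE]; apply: le_trans (q_sum sp).
by rewrite yE lerDl.
Qed.

(* The control is the variation on [[0, t]], which is superadditive. *)
Lemma variation_control : exists M : R -> R, forall s t,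
  0 <= s -> s <= t -> t <= T -> q s t <= M t - M s.
Proof.
exists (fun t => sup (sums t)) => s t s0; rewrite le_eqVlt => /predU1P[<-|st] tT.
  by rewrite q_refl subrr.
rewrite lerBrDr addrC -lerBrDr; apply: sup_le_ub; first exact: sums_nonempty.
move=> y ys; rewrite lerBrDr; apply: ub_le_sup; first exact: sums_bounded.
exact: sums_extend.
Qed.

End variation_control.

Section absolutely_continuous_variation.
Context {R : realType} (V : normedModType R) (T : R) (x : R -> V).
Hypotheses (T_gt0 : 0 < T) (acx : absolutely_continuous 0 T x).

Lemma absolutely_continuous_bounded :
  exists2 B, 0 <= B & forall t, 0 <= t <= T -> `|x t| <= B.
Proof.
have cD : compact (`[0, T]%classic : set R^o) by exact: segment_compact.
have D0 : (`[0, T]%classic : set R^o) 0 by rewrite /= in_itv /= lexx ltW.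
pose P (s t : R^o) := `|x s - x t|.
have tri s t r : `[0, T]%classic s -> `[0, T]%classic t -> `[0, T]%classic r ->
  P s r <= P s t + P t r by move=> _ _ _; exact: ler_distD.
have cont z : `[0, T]%classic z -> forall e, 0 < e -> exists2 h, 0 < h &
    forall s, `[0, T]%classic s -> `|s - z| < h -> P s z < e.
  move=> zT e e0; have [h h0 xh] := absolutely_continuous_uniform acx e0.
  exists h => // s sT sz.
  by apply: xh.
have [B B0 PB] := compact_pseudometric_bounded cD tri cont D0.
exists (B + `|x 0|); first by rewrite addr_ge0.
move=> t tT; rewrite -(subrK (x 0) (x t)); apply: le_trans (ler_normD _ _) _.
by rewrite lerD2r; apply: PB; rewrite /= in_itv.
Qed.

(** Stretches shorter than [d] contribute at most 1. Longer ones are cut by [half_split], applied to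
    the times themselves; the middle cell may be long, but contributes at most [2 * B]. *)
Lemma absolutely_continuous_variation : exists C, forall (t : nat -> R) i j,
  (i <= j)%N ->
  (forall k l, (i <= k)%N -> (k <= l)%N -> (l <= j)%N -> t k <= t l) ->
  0 <= t i -> t j <= T -> \sum_(i <= k < j) `|x (t k.+1) - x (t k)| <= C.
Proof.
have [B B0 xB] := absolutely_continuous_bounded.
have [d d0 xd] := acx ltr01.
have base (t : nat -> R) i j : (i <= j)%N ->
    (forall k l, (i <= k)%N -> (k <= l)%N -> (l <= j)%N -> t k <= t l) ->
    0 <= t i -> t j <= T -> t j - t i < d ->
    \sum_(i <= k < j) `|x (t k.+1) - x (t k)| <= 1.
  move=> ij mono ti tj tij.
  have shift (F : nat -> R) :
      \sum_(i <= k < j) F k = \sum_(k < j - i) F (k + i)%N.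
    by rewrite -{1}[i]add0n big_addn big_mkord.
  have kj (k : 'I_(j - i)) : ((k + i).+1 <= j)%N by rewrite addnC -ltn_subRL ltn_ord.
  rewrite shift; apply/ltW.
  apply: (xd _ (fun k : 'I_(j - i) => t (k + i)%N) (fun k => t (k + i).+1)).
  - move=> k; have lk := leq_addl k i; split; last split.
    + by apply: le_trans ti _; apply: mono => //; exact: ltnW.
    + exact: mono.
    + by apply: le_trans tj; apply: mono => //; exact: leqW.
  - move=> k l kl; have [h|h|h] := ltngtP k l; last by move/val_inj: h kl => ->; rewrite eqxx.
      left; apply: mono; [exact: leqW (leq_addl _ _)|by rewrite -addSn leq_add2r|].
      exact: ltnW.
    right; apply: mono; [exact: leqW (leq_addl _ _)|by rewrite -addSn leq_add2r|].
    exact: ltnW.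
  - rewrite -(shift (fun k => t k.+1 - t k)) telescope_sumr//.
have main n : exists C, forall (t : nat -> R) i j, (i <= j)%N ->
    (forall k l, (i <= k)%N -> (k <= l)%N -> (l <= j)%N -> t k <= t l) ->
    0 <= t i -> t j <= T -> t j - t i < 2 ^+ n * d ->
    \sum_(i <= k < j) `|x (t k.+1) - x (t k)| <= C.
  elim: n => [|n [C IH]]; first by exists 1 => t i j; rewrite expr0 mul1r; exact: base.
  exists (C + (2 * B + C)) => t i j; rewrite leq_eqVlt => /predU1P[<-|ij] mono ti tj tij.
    (* Nonnegativity of [C] is read off from an empty sum. *)
    rewrite big_geq//; have := IH (fun=> 0) 0%N 0%N (leqnn _) (fun _ _ _ _ _ => lexx _).
    rewrite lexx ltW// subrr mulr_gt0 ?exprn_gt0// big_geq// => /(_ isT isT isT) C0.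
    by rewrite !addr_ge0// mulr_ge0.
  have [k [/andP[ik kj] mk mk1]] := half_split (m := t) ij mono.
  rewrite (big_cat_nat ik (ltnW kj)) (big_ltn kj) /=.
  have tk : t i <= t k by apply: mono => //; exact: ltnW.
  have tk1 : t k <= t k.+1 by exact: mono.
  have tkj : t k.+1 <= t j by apply: mono => //; exact: leqW.
  have half : (t j - t i) / 2 < 2 ^+ n * d.
    by rewrite ltr_pdivrMr// mulrAC -exprSr.
  apply: lerD; last apply: lerD.
  - apply: IH => //; last by apply: le_lt_trans half.
      by move=> l l' il ll' lk; apply: mono => //; exact: leq_trans (ltnW kj).
    by apply: le_trans tj; apply: mono => //; exact: ltnW.
  - apply: le_trans (ler_normB _ _) _; rewrite mulrDl mul1r.
    by apply: lerD; apply: xB; apply/andP; split; lra.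
  - apply: IH => //; last by apply: le_lt_trans half.
      by move=> l l' il ll' lk; apply: mono => //; apply: leq_trans il; exact: leqW.
    by lra.
have [n nT] : exists n, T < 2 ^+ n * d.
  pose n := Num.truncn (T / d); exists n.+1.
  rewrite -ltr_pdivrMr//; apply: lt_le_trans (truncnS_gt _) _.
  by rewrite -natrX ler_nat ltnW// ltn_expl.
have [C HC] := main n; exists C => t i j ij mono ti tj; apply: HC => //.
by apply: le_lt_trans nT; lra.
Qed.

Lemma absolutely_continuous_control : exists M : R -> R, forall s t,
  0 <= s -> s <= t -> t <= T -> `|x t - x s| <= M t - M s.
Proof.
have [C HC] := absolutely_continuous_variation.
apply: (@variation_control _ T C (fun s t => `|x t - x s|)) => //.
  by move=> s; rewrite subrr normr0.
move=> s sp; have [s_last s_inc] := itv_partition_points sp.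
apply: (HC (nth T (0 :: s)) 0%N (size s)) => //; last by rewrite s_last.
move=> k l _; elim: l => [|l IH]; first by rewrite leqn0 => /eqP ->.
rewrite leq_eqVlt => /predU1P[->//|]; rewrite ltnS => kl ls.
apply: le_trans (ltW (s_inc _ ls)); apply: IH => //; exact: ltnW.
Qed.

End absolutely_continuous_variation.

Lemma powRVK (R : realType) (p x : R) : 0 < p -> 0 <= x -> (x `^ p^-1) `^ p = x.
Proof. by move=> p0 x0; rewrite -powRrM mulVf ?gt_eqF// powRr1. Qed.

Lemma powR_small (R : realType) (c e : R) : 0 < c -> 0 < e ->
  exists2 h, 0 < h & forall z, 0 <= z -> z < h -> z `^ c <= e.
Proof.
move=> c0 e0; exists (e `^ c^-1); first exact: powR_gt0.
move=> z z0 zh; rewrite -(powRVK c0 (ltW e0)).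
by apply: ge0_ler_powR; rewrite ?nnegrE ?powR_ge0// ltW.
Qed.

Section holder_young.
Context {R : realType} (d : nat) (E : normedModType R) (T : R).
Variables (psi : R -> E -> 'Hom('rV[R]_d, R^o)) (eta : R -> 'rV[R]_d)
  (kappa : R) (K : R -> R) (x : R -> E).
Hypotheses (T_gt0 : 0 < T)
  (eta_cont : {within `[0, T], continuous eta})
  (eta_var : forall p : R, 2 < p -> (p_variation 0 T p eta < +oo)%E)
  (kappa_gt : 2^-1 < kappa)
  (psi_holder : forall (rho s t : R) (x y : E), 0 <= rho ->
     s \in `[0, T] -> t \in `[0, T] -> `|x| <= rho -> `|y| <= rho ->
     op_norm (psi t x - psi s y)
       <= K rho * (`|t - s| `^ kappa + `|x - y| `^ kappa))
  (acx : absolutely_continuous 0 T x).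

(** It is the [p]-th powers whose sums over partitions are superadditive, so the control is built
    for them and the root is taken at the end. *)
Lemma p_variation_control (p : R) : 0 < p -> (p_variation 0 T p eta < +oo)%E ->
  exists M : R -> R, forall s t, 0 <= s -> s <= t -> t <= T ->
    M s <= M t /\ `|eta t - eta s| <= (M t - M s) `^ p^-1.
Proof.
move=> p0; rewrite /p_variation; set S := [set _ | _ in _] => Sp.
have S_lt : (ereal_sup S < +oo)%E.
  by apply: lty_poweRy Sp; rewrite invr_eq0 gt_eqF.
have S_ge s : itv_partition 0 T s ->
    ((\sum_(0 <= i < size s) `|eta (nth T (0 :: s) i.+1) - eta (nth T (0 :: s) i)| `^ p)%:E
     <= ereal_sup S)%E.
  by move=> sp; apply: ereal_sup_ubound; exists s.
have [M MP] : exists M : R -> R, forall s t, 0 <= s -> s <= t -> t <= T ->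
    `|eta t - eta s| `^ p <= M t - M s.
  apply: (@variation_control _ T (fine (ereal_sup S))
    (fun s t => `|eta t - eta s| `^ p)).
  - by move=> s t; exact: powR_ge0.
  - by move=> s; rewrite subrr normr0 powR0// gt_eqF.
  - move=> s sp; rewrite -lee_fin fineK; first exact: S_ge.
    rewrite fin_numE (lt_eqF S_lt) andbT gt_eqF//.
    exact: lt_le_trans (ltNyr _) (S_ge s sp).
exists M => s t s0 st tT; have H := MP s t s0 st tT.
split; first by rewrite -subr_ge0; apply: le_trans (powR_ge0 _ _) H.
rewrite -(powRVK (_ : 0 < p^-1) (normr_ge0 (eta t - eta s))) ?invr_gt0// invrK.
apply: ge0_ler_powR; rewrite ?nnegrE ?powR_ge0 ?invr_ge0// ?(ltW p0)//.
exact: le_trans (powR_ge0 _ _) H.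
Qed.

Let le_row_op_norm (A : 'Hom('rV[R]_d, R^o)) v : `|A v| <= op_norm A * `|v|.
Proof.
pose L : {linear 'rV[R]_d -> R^o} := A.
have [C _ AC] := rV_linear_bounded L.
exact: (op_norm_ge (A := L) v AC).
Qed.

Let eta_unif e : 0 < e -> exists2 h, 0 < h & forall s t,
  0 <= s <= T -> 0 <= t <= T -> `|s - t| < h -> `|eta s - eta t| < e.
Proof.
have cD : compact (`[0, T]%classic : set R^o) by exact: segment_compact.
pose P (s t : R^o) := `|eta s - eta t|.
have sym s t : P s t = P t s by exact: distrC.
have tri s t r : `[0, T]%classic s -> `[0, T]%classic t -> `[0, T]%classic r ->
  P s r <= P s t + P t r by move=> _ _ _; exact: ler_distD.
have cont z : `[0, T]%classic z -> forall e, 0 < e -> exists2 h, 0 < h &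
    forall s, `[0, T]%classic s -> `|s - z| < h -> P s z < e.
  by move=> zT e' e'0; exact: (within_continuousP (V := R^o) eta_cont zT e'0).
move=> /(compact_pseudometric_uniform cD sym tri cont)[h h0 H].
by exists h => // s t sT tT; apply: H.
Qed.

Lemma holder_young_integral :
  exists S, is_young_integral 0 T (fun t => psi t (x t)) eta S.
Proof.
have k_gt := kappa_gt.
(* Strictly between [1 / 2] and [kappa]; the cap at [3 / 4] keeps [b] below positive. *)
pose kappa' : R := Num.min ((kappa + 2^-1) / 2) (3 / 4).
have k'_lt : kappa' < kappa.
  by rewrite /kappa' gt_min; apply/orP; left; lra.
have k'_gt : 2^-1 < kappa' by rewrite /kappa' lt_min; apply/andP; split; lra.
have k'_le : kappa' <= 3 / 4 by rewrite /kappa' ge_min lexx orbT.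
(* The midpoint of [1 - kappa'] and [1 / 2]: thus [b^-1 > 2], so that the variation of [eta] is
   finite, and [kappa' + b > 1]. *)
pose b : R := (3 / 2 - kappa') / 2.
have b0 : 0 < b by rewrite /b; lra.
have b2 : b < 2^-1 by rewrite /b; lra.
have kb : 1 < kappa' + b by rewrite /b; lra.
have p2 : 2 < b^-1.
  by rewrite -[X in X < _]invrK ltf_pV2 ?posrE ?invr_gt0.
have p0 : 0 < b^-1 by rewrite invr_gt0.
have [M1 M1P] := p_variation_control p0 (eta_var p2).
have [M2 M2P] := absolutely_continuous_control T_gt0 acx.
have [B B0 xB] := absolutely_continuous_bounded T_gt0 acx.
rewrite invrK in M1P.
(* One control for time, for the variation of [eta] with exponent [b^-1], and for the variation of
   [x]. *)
pose m t := t + M1 t + M2 t.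
pose phi t (y : 'rV[R]_d) : R := psi t (x t) y.
pose K' := `|K B|.
have phi_diff s t y : 0 <= s <= T -> 0 <= t <= T -> `|phi t y - phi s y| <=
    K' * (`|t - s| `^ kappa + `|x t - x s| `^ kappa) * `|y|.
  move=> sT tT; have -> : phi t y - phi s y = (psi t (x t) - psi s (x s)) y.
    by rewrite /phi !lfunE /= !lfunE.
  apply: le_trans (le_row_op_norm _ _) _; rewrite ler_wpM2r//.
  have sT' : s \in `[0, T] by rewrite in_itv.
  have tT' : t \in `[0, T] by rewrite in_itv.
  apply: le_trans (psi_holder B0 sT' tT' (xB _ tT) (xB _ sT)) _.
  by rewrite ler_wpM2r ?ler_norm// addr_ge0// powR_ge0.
have K0 : 0 <= K' by exact: normr_ge0.
have m_ge s t : 0 <= s -> s <= t -> t <= T ->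
    [/\ t - s <= m t - m s, M1 t - M1 s <= m t - m s & `|x t - x s| <= m t - m s].
  move=> s0 st tT; have [h1 _] := M1P s t s0 st tT; have h2 := M2P s t s0 st tT.
  have := normr_ge0 (x t - x s); rewrite /m.
  move: (`|x t - x s|) h2 => z h2 z0.
  by split; lra.
have kk0 : 0 < kappa - kappa' by rewrite subr_gt0.
have k'0 : 0 < kappa' by apply: lt_trans k'_gt; rewrite invr_gt0.
have k0 : 0 < kappa by exact: lt_trans k'_lt.
(* The first factor becomes small with the mesh, the second is controlled by [m]. *)
have powk z : 0 <= z -> z `^ kappa = z `^ (kappa - kappa') * z `^ kappa'.
  by move=> z0; rewrite -powRD subrK// gt_eqF.
have [C C0 C_ge] := discrete_young_constant kb.
have phi_add t : {morph phi t : y z / y + z} by move=> y z; rewrite /phi linearD.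
have m_mono s t : 0 <= s -> s <= t -> t <= T -> m s <= m t.
  by move=> s0 st tT; have [h _ _] := m_ge s t s0 st tT; rewrite -subr_ge0;
    apply: le_trans h; rewrite subr_ge0.
have eta_le s t : 0 <= s -> s <= t -> t <= T -> `|eta t - eta s| <= (m t - m s) `^ b.
  move=> s0 st tT; have [h1 h2] := M1P s t s0 st tT; apply: le_trans h2 _.
  have [_ h3 _] := m_ge s t s0 st tT; have mm := m_mono s t s0 st tT.
  by apply: ge0_ler_powR; rewrite ?nnegrE ?subr_ge0// ltW.
pose L := K' * (T `^ kappa + (B + B) `^ kappa).
have L0 : 0 <= L by rewrite mulr_ge0// addr_ge0// powR_ge0.
have phi_bound t y : 0 <= t <= T ->
    `|phi t y| <= (op_norm (psi 0 (x 0)) + L) * `|y|.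
  move=> tT; have T0 : 0 <= (0 : R) <= T by apply/andP; split => //; exact: ltW.
  rewrite -(subrK (phi 0 y) (phi t y)) addrC; apply: le_trans (ler_normD _ _) _.
  rewrite mulrDl; apply: lerD; first exact: le_row_op_norm.
  apply: le_trans (phi_diff _ _ _ T0 tT) _; rewrite ler_wpM2r// ler_wpM2l//.
  have /andP[t0 tT1] := tT.
  have pk u v : 0 <= u -> u <= v -> u `^ kappa <= v `^ kappa.
    move=> u0 uv; have v0 := le_trans u0 uv.
    by apply: ge0_ler_powR; rewrite ?nnegrE// ltW.
  apply: lerD; apply: pk; rewrite ?normr_ge0//; first by rewrite subr0 ger0_norm.
  by apply: le_trans (ler_normB _ _) _; apply: lerD; exact: xB.
have psi0 : 0 <= op_norm (psi 0 (x 0)).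
  pose A : {linear 'rV[R]_d -> R^o} := psi 0 (x 0).
  have [c _ Ac] := rV_linear_bounded A.
  exact: (bounded_op_norm_ge0 (A := A) Ac).
have phi_le e : 0 < e -> exists2 h, 0 < h & forall s t y,
     0 <= s -> s <= t -> t <= T -> t - s < h ->
     `|phi t y - phi s y| <= e * (m t - m s) `^ kappa' * `|y|.
  (* The 2 accounts for the time term and the space term of the Hölder bound. *)
  move=> e0; pose e1 := e / (2 * (K' + 1)).
  have K1 : 0 < 2 * (K' + 1) by rewrite mulr_gt0// ltr_wpDl.
  have e10 : 0 < e1 by rewrite divr_gt0.
  have [h1 h10 H1] := powR_small kk0 e10.
  have [h2 h20 H2] := absolutely_continuous_uniform acx h10.
  exists (Num.min h1 h2); first by rewrite lt_min h10.
  move=> s t y s0 st tT; rewrite lt_min => /andP[ts1 ts2].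
  have sT : 0 <= s <= T by rewrite s0 (le_trans st).
  have tT' : 0 <= t <= T by rewrite tT (le_trans s0).
  have [g1 _ g2] := m_ge s t s0 st tT; have mm := m_mono s t s0 st tT.
  have small z : 0 <= z -> z < h1 -> z <= m t - m s ->
      z `^ kappa <= e1 * (m t - m s) `^ kappa'.
    move=> z0 zh zm; rewrite powk//; apply: ler_pM; rewrite ?powR_ge0//.
      exact: H1.
    by apply: ge0_ler_powR; rewrite ?nnegrE ?subr_ge0// ltW.
  apply: le_trans (phi_diff _ _ _ sT tT') _; rewrite ler_wpM2r//.
  have ts0 : 0 <= t - s by rewrite subr_ge0.
  apply: (@le_trans _ _ (K' * (e1 * (m t - m s) `^ kappa' + e1 * (m t - m s) `^ kappa'))).
    rewrite ler_wpM2l//; apply: lerD.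
      by apply: small; rewrite ?normr_ge0// ger0_norm.
    apply: small; rewrite ?normr_ge0//; apply: H2 => //.
    by rewrite ger0_norm.
  have -> : K' * (e1 * (m t - m s) `^ kappa' + e1 * (m t - m s) `^ kappa') =
     e * (m t - m s) `^ kappa' * (K' / (K' + 1)).
    by rewrite /e1; field; rewrite gt_eqF// ltr_wpDl.
  have Kp : 0 < K' + 1 by rewrite ltr_wpDl.
  rewrite ler_piMr ?mulr_ge0 ?powR_ge0 ?(ltW e0)//.
  by rewrite ler_pdivrMr// mul1r lerDl.
have [S SP] := riemann_sums_converge T_gt0 phi_add (ltW k'0) (ltW b0) kb
  (addr_ge0 psi0 L0) m_mono eta_le eta_unif phi_le phi_bound C0 C_ge.
exists S => e e0; have [h h0 H] := SP e e0; exists h => // s tau sp /= s_tau.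
have [s_last s_inc] := itv_partition_points sp.
apply: H => // k ks.
- exact: ltW (s_inc k ks).
- by have [] := s_tau k ks.
- by have [] := s_tau k ks.
Qed.

End holder_young.

(** * Measurability and integrability of the running cost *)

Section integrability.
Context d (X : measurableType d) (R : realType).
Variables (mu : {measure set X -> \bar R}) (D : set X).
Hypotheses (mD : measurable D) (muD : (mu D < +oo)%E).

Lemma integrable_cst (k : R) : mu.-integrable D (EFin \o cst k).
Proof.
apply: measurable_bounded_integrable => //; exists `|k|; split; first exact: num_real.
by move=> M kM t _ /=; exact: ltW.
Qed.

(** Completeness gives measurability, although nothing is known of [h] on the null set. *)
Lemma integrable_ae_cst (h : X -> R) (k : R) : measure_is_complete mu ->
  {ae mu, forall t, D t -> h t = k} -> mu.-integrable D (EFin \o h).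
Proof.
move=> cmu hk; have ik := integrable_cst k.
have hk' : ae_eq mu D (EFin \o cst k) (EFin \o h).
  move: hk; apply: (@filterS _ _ (ae_filter_ringOfSetsType mu)).
  by move=> t + Dt => /(_ Dt) /= ->.
have mk : measurable_fun D (EFin \o cst k) by have /integrableP[] := ik.
have mh := ae_measurable_fun cmu hk' mk.
apply/integrableP; split => //.
have /integrableP[_] := ik; apply: le_lt_trans.
rewrite le_eqVlt; apply/orP; left; apply/eqP/esym; apply: ae_eq_integral => //.
- exact: measurableT_comp.
- exact: measurableT_comp.
- exact: ae_eq_abse.
Qed.

Variable c : X -> R.
Hypothesis mc : measurable_fun D c.

Let mcE : measurable_fun D (EFin \o c). Proof. exact/measurable_EFinP. Qed.

Lemma integral_funeneg_lty (h : X -> R) : mu.-integrable D (EFin \o h) ->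
  (forall t, D t -> h t <= c t) -> (\int[mu]_(t in D) (EFin \o c)^\- t < +oo)%E.
Proof.
move=> /integrableP[mh ih] hc; apply: le_lt_trans ih.
apply: ge0_le_integral => //.
- exact: measurable_funeneg.
- exact: measurableT_comp.
- move=> t Dt; rewrite funenegE ge_max abse_ge0 andbT /= lee_fin.
  by rewrite -normrN (le_trans _ (ler_norm _))// lerN2 hc.
Qed.

Hypothesis c_neg : (\int[mu]_(t in D) (EFin \o c)^\- t < +oo)%E.

Lemma integral_gt_ninfty : (-oo < \int[mu]_(t in D) (c t)%:E)%E.
Proof.
rewrite integralE; apply: (@lt_le_trans _ _ (- \int[mu]_(t in D) (EFin \o c)^\- t)%E).
  rewrite ltNye_eq fin_numN ge0_fin_numE ?c_neg//.
  by apply: integral_ge0 => t _; exact: funeneg_ge0.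
rewrite -[X in (X <= _)%E]add0e leeD2r//.
by apply: integral_ge0 => t _; exact: funepos_ge0.
Qed.

(** With a finite negative part, an infinite positive part would make the integral [+oo]. *)
Lemma integrable_fin_num_integral :
  (\int[mu]_(t in D) (c t)%:E)%E \is a fin_num -> mu.-integrable D (EFin \o c).
Proof.
move=> fc; apply/integrableP; split => //.
have -> : (\int[mu]_(t in D) `|(EFin \o c) t| =
    \int[mu]_(t in D) (EFin \o c)^\+ t + \int[mu]_(t in D) (EFin \o c)^\- t)%E.
  rewrite -ge0_integralD//; last 2 first.
  - exact: measurable_funepos.
  - exact: measurable_funeneg.
  by apply: eq_integral => t _; rewrite -/((abse \o (EFin \o c)) t) fune_abse.
apply: lte_add_pinfty => //; rewrite ltey; apply/eqP => cE; move: fc.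
rewrite integralE cE fin_numE => /andP[_ /eqP]; apply; apply: addye.
by rewrite eqe_oppLR /=; apply/eqP => cE'; move: c_neg; rewrite cE'.
Qed.

Lemma ae_le_affine_integral_lty (f : X -> R) (k L : R) :
  mu.-integrable D (EFin \o c) -> measurable_fun D f ->
  (forall t, D t -> 0 <= f t) -> {ae mu, forall t, D t -> f t <= k * (c t + L)} ->
  (\int[mu]_(t in D) (f t)%:E < +oo)%E.
Proof.
move=> ic mf f0 fc.
have : mu.-integrable D (fun t => (k%:E * ((c t)%:E + L%:E))%E).
  by apply: integrableZl => //; apply: integrableD => //; exact: integrable_cst.
move=> /integrableP[mg]; apply: le_lt_trans; apply: ae_ge0_le_integral => //.
- exact/measurable_EFinP.
- exact: measurableT_comp.
- move: fc; apply: (@filterS _ _ (ae_filter_ringOfSetsType mu)).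
  by move=> t + Dt => /(_ Dt) ft; rewrite /= lee_fin (le_trans ft)// ler_norm.
Qed.

End integrability.

Lemma measurable_powR_comp d (X : measurableType d) (R : realType) (D : set X)
    (v : X -> R) (r : R) :
  measurable_fun D v -> measurable_fun D (fun t => v t `^ r).
Proof. by move=> mv; apply: (measurableT_comp (measurable_powR r)). Qed.

(** On a set of finite measure [v <= v ^ r + 1] replaces Hölder's inequality. *)
Lemma ge0_integral_le_powR d (X : measurableType d) (R : realType)
    (mu : {measure set X -> \bar R}) (D : set X) (v : X -> R) (r : R) :
  measurable D -> (mu D < +oo)%E -> 1 <= r -> measurable_fun D v ->
  (forall t, D t -> 0 <= v t) -> (\int[mu]_(t in D) (v t `^ r)%:E < +oo)%E ->
  (\int[mu]_(t in D) (v t)%:E < +oo)%E.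
Proof.
move=> mD muD r1 mv v0 vr.
have mvr := measurable_powR_comp r mv.
have ivr : mu.-integrable D (EFin \o (fun t => v t `^ r)).
  apply/integrableP; split; first exact/measurable_EFinP.
  apply: le_lt_trans vr; rewrite le_eqVlt; apply/orP; left; apply/eqP.
  by apply: eq_integral => t _; rewrite /= ger0_norm// powR_ge0.
apply: (ae_le_affine_integral_lty (k := 1) (L := 1) mD muD ivr mv v0).
apply: aeW => t Dt; rewrite mul1r.
have [v1|/ltW v1] := leP (v t) 1; first by rewrite (le_trans v1)// lerDr powR_ge0.
apply: (@le_trans _ _ (v t `^ r)); last by rewrite lerDl.
by rewrite -[leLHS]powRr1 ?v0// ler_powR.
Qed.

(** * Measurability of maps into separable normed spaces *)

Section separable.
Context {R : realType}.

Definition separable_norm (V : normedModType R) :=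
  exists s : nat -> V, forall x e, 0 < e -> exists n, `|x - s n| < e.

Lemma separable_real : separable_norm R^o.
Proof.
exists (fun n => ratr (odflt 0%Q (unpickle n))) => x e e0.
have [|q] := @rat_in_itvoo R (x - e) x; first by rewrite ltrBlDr ltrDl.
rewrite in_itv /= => /andP[q1 q2]; exists (pickle q); rewrite pickleK /=.
by rewrite ger0_norm ?subr_ge0 1?ltW// ltrBlDr -ltrBlDl.
Qed.

Lemma separable_vector (E : normedVectType R) : separable_norm E.
Proof.
exists (fun n => \sum_(i < \dim {:E})
  ratr (odflt [ffun=> 0%Q] (unpickle n) i) *: (vbasis {:E})`_i) => x e e0.
have [q qP] := rational_coordinates_dense x e0.
by exists (pickle q); rewrite pickleK.
Qed.

Lemma separable_prod (V W : normedModType R) :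
  separable_norm V -> separable_norm W -> separable_norm (V * W)%type.
Proof.
move=> [s sP] [s' s'P].
exists (fun n => let kl := odflt (0%N, 0%N) (unpickle n) in (s kl.1, s' kl.2)).
move=> [x y] e e0; have [k kP] := sP x e e0; have [l lP] := s'P y e e0.
by exists (pickle (k, l)); rewrite pickleK /= prod_normE /= gt_max kP.
Qed.

Context d (X : measurableType d) (D : set X).

(** Measurability tested by distances to fixed points. It passes to pairs at once, as the product
    norm is a maximum, and separability recovers preimages of open sets. *)
Definition measurable_norms (V : normedModType R) (z : X -> V) :=
  forall c, measurable_fun D (fun t => `|z t - c|).

Lemma measurable_norms_pair (V W : normedModType R) (z : X -> V) (w : X -> W) :
  measurable_norms z -> measurable_norms w ->
  measurable_norms (fun t => (z t, w t)).
Proof.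
move=> mz mw c.
rewrite (_ : (fun t => _) = (fun t => Num.max `|z t - c.1| `|w t - c.2|)).
  exact: measurable_maxr.
by apply/funext => t; rewrite prod_normE.
Qed.

(** [O] is the union of those balls contained in it that have a centre in the dense sequence and
    radius [l.+1%:R^-1], and these are countably many. *)
Lemma measurable_preimage_open (V : normedModType R) (z : X -> V) (O : set V) :
  measurable D -> separable_norm V -> measurable_norms z -> open O ->
  measurable (D `&` z @^-1` O).
Proof.
move=> mD [s sP] mz oO.
pose I := [set n : nat | let kl := odflt (0%N, 0%N) (unpickle n) in
  [set y | `|y - s kl.1| < kl.2.+1%:R^-1] `<=` O].
rewrite (_ : _ `&` _ = \bigcup_(n in I) let kl := odflt (0%N, 0%N) (unpickle n) in
    (D `&` (fun t => `|z t - s kl.1|) @^-1` `]-oo, kl.2.+1%:R^-1[)).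
  apply: bigcup_measurable => n _ /=; apply: mz => //; exact: measurable_itv.
apply/seteqP; split => [t [Dt Ot]|t [n nI /=]]; last first.
  by rewrite in_itv /= => -[Dt zt]; split => //; exact: nI.
have : nbhs (z t) O by rewrite nbhsE /=; exists O.
move=> /nbhs_normP[e /= e0 eO].
have [l le] : exists l : nat, l.+1%:R^-1 < e / 2.
  have [l _ lP] := near_infty_natSinv_lt (PosNum (divr_gt0 e0 (ltr0n R 2))).
  by exists l; exact: lP (leqnn l).
have [k kl] := sP (z t) l.+1%:R^-1 (ltac:(by rewrite invr_gt0)).
exists (pickle (k, l)); rewrite /I /= pickleK //=.
  move=> y /= yk; apply: eO => /=.
  rewrite -(subrK (s k) (z t)) -addrA; apply: le_lt_trans (ler_normD _ _) _.
  by rewrite (splitr e) ltrD// ?(lt_trans kl)// distrC (lt_trans yk).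
Qed.

End separable.

Section running_cost.
Context {R : realType} (T : R) (E : normedVectType R) (U : set E).
Variables (phi : R -> E -> E -> R) (Cphi delta r : R) (x u : R -> E).
Notation leb := (@completed_lebesgue_measure R).
Hypotheses (T_gt0 : 0 < T) (U_closed : closed U)
  (phi_cont : {within [set z : R * E * E | z.1.1 \in `[0, T] /\ U z.2],
     continuous (fun z => phi z.1.1 z.1.2 z.2)})
  (Cphi_gt0 : 0 < Cphi) (delta_gt0 : 0 < delta) (r_gt1 : 1 < r)
  (phi_ge : forall (t : R) (x u : E), t \in `[0, T] -> U u ->
     Cphi * (`|u| `^ r - `|x| `^ delta) <= phi t x u)
  (u_meas : lebesgue_measurable `[0, T] u) (u_in : takes_values_in_U U T u)
  (acx : absolutely_continuous 0 T x).

Let D : set (lebesgueType R) := [set` `[0, T]].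

Lemma measurable_lebesgue_segment : @measurable _ (lebesgueType R) D.
Proof. by apply: borel_lebesgue_measurable; exact: measurable_itv. Qed.
Let mD := measurable_lebesgue_segment.

Lemma lebesgue_segment_lty : (leb D < +oo)%E.
Proof.
have -> : leb D = @lebesgue_measure R [set` `[0, T]] by [].
by rewrite lebesgue_measure_itv /= lte_fin T_gt0 -EFinB ltry.
Qed.
Let leb_D := lebesgue_segment_lty.

Lemma measurable_lebesgue_norm :
  @measurable_fun _ _ (lebesgueType R) (measurableTypeR R) D (fun t => `|u t|).
Proof. exact: (lebesgue_measurable_continuous (@norm_continuous _ E) u_meas). Qed.

Let norms_u : @measurable_norms R _ (lebesgueType R) D E u.
Proof.
move=> c.
have cc : continuous (fun y : E => `|y - c|).
  move=> y; apply: (@continuous_comp _ _ _ (fun y : E => y - c) (fun y : E => `|y|)).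
    by apply: cvgB => //; exact: cvg_cst.
  exact: norm_continuous.
exact: (lebesgue_measurable_continuous cc u_meas).
Qed.

Let norms_of_continuous (V : normedModType R) (y : R -> V) :
  (forall e, 0 < e -> exists2 h, 0 < h & forall s t,
     0 <= s <= T -> 0 <= t <= T -> `|s - t| < h -> `|y s - y t| < e) ->
  @measurable_norms R _ (lebesgueType R) D V y.
Proof.
move=> cy c; apply: borel_lebesgue_measurable_fun; first exact: measurable_itv.
apply: subspace_continuous_measurable_fun; first exact: measurable_itv.
apply/subspace_continuousP => t tT; apply/cvgrPdist_lt => e e0.
have [h h0 yh] := cy _ e0; apply/nbhs_normP; exists h => // s /= ts sT.
apply: le_lt_trans (ler_dist_dist _ _) _.
have -> : y t - c - (y s - c) = y t - y s by rewrite opprB addrA subrK.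
by apply: yh.
Qed.

Let process_at t : R * E * E := (t : R, x t, u t).

Let norms_process : @measurable_norms R _ (lebesgueType R) D (R * E * E)%type process_at.
Proof.
apply: measurable_norms_pair; last exact: norms_u.
apply: (@measurable_norms_pair R _ (lebesgueType R) D R^o E idfun x).
  by apply: norms_of_continuous => e e0; exists e.
by apply: norms_of_continuous => e e0; exact: absolutely_continuous_uniform.
Qed.

Let separable_process : separable_norm (R * E * E)%type.
Proof.
apply: separable_prod (separable_vector E).
exact: (@separable_prod R R^o E separable_real (separable_vector E)).
Qed.

Let A := D `&` u @^-1` U.

Let mA : @measurable _ (lebesgueType R) A.
Proof.
have -> : A = D `\` (D `&` u @^-1` (~` U)).
  apply/seteqP; split => t; first by move=> [Dt Ut]; split => // -[_].
  by move=> [Dt nU]; split => //; apply: contrapT => Ut; apply: nU.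
apply: measurableD; first exact: mD.
apply: measurable_preimage_open norms_u _ => //; first exact: separable_vector.
by rewrite openC.
Qed.

Let negligible_bad : leb.-negligible (D `\` A).
Proof.
move: u_in => [N [mN N0 uN]]; exists N; split => // t [Dt nA].
by apply: uN => /= /(_ Dt) Ut; apply: nA.
Qed.

Let c : R -> R := fun t => phi t (x t) (u t).

(** On [A], where [u] lies in [U], a superlevel set of [c] is cut out by an open set [W] of the
    product space; the rest is negligible, hence measurable by completeness. *)
Lemma running_cost_measurable :
  @measurable_fun _ _ (lebesgueType R) (measurableTypeR R) D c.
Proof.
apply: (measurability _ (RGenOInfty.measurableE R)) => // _ [_ [y ->] <-].
have /continuousP /(_ `]y, +oo[%classic (interval_open _ _)) := phi_cont.
move=> /(_ isT isT) /open_subspaceP[W oW WP].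
have -> : D `&` c @^-1` `]y, +oo[ = (A `&` (D `&` process_at @^-1` W))
    `|` ((D `\` A) `&` c @^-1` `]y, +oo[).
  have key t : A t -> (W (process_at t) <-> `]y, +oo[%classic (c t)).
    move=> [Dt Ut]; have := WP => /seteqP[H1 H2]; split => [Wt|ct].
      by have [] := H1 (process_at t) (conj Wt (conj Dt Ut)).
    by have [] := H2 (process_at t) (conj ct (conj Dt Ut)).
  apply/seteqP; split => [t [Dt ct]|t [[At [Dt Wt]]|[[Dt _] ct]]] //.
    have [At|nAt] := pselect (A t); last by right.
    by left; split => //; split => //; apply/key.
  by split => //; apply/key.
apply: measurableU.
  by apply: measurableI => //; apply: measurable_preimage_open.
apply: completed_lebesgue_measure_is_complete.
by apply: negligibleS negligible_bad => t [].
Qed.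

Lemma running_cost_lower_bound : exists L : R,
  [/\ 0 <= L, {ae leb, forall t, D t -> `|u t| `^ r <= Cphi^-1 * (c t + L)} &
    exists2 h : R -> R, leb.-integrable D (EFin \o h) &
      forall t, D t -> h t <= c t].
Proof.
have [B B0 xB] := absolutely_continuous_bounded T_gt0 acx.
pose L := Cphi * B `^ delta; have L0 : 0 <= L by rewrite mulr_ge0 ?powR_ge0// ltW.
have xL t : D t -> Cphi * `|x t| `^ delta <= L.
  move=> Dt; rewrite ler_pM2l//; apply: ge0_ler_powR; rewrite ?nnegrE ?(ltW delta_gt0)//.
  by apply: xB; move: Dt; rewrite /D /= in_itv.
exists L; split => //.
  move: u_in; apply: filterS; first exact: (ae_filter_ringOfSetsType leb).
  move=> t Ut Dt; rewrite ler_pdivlMl//.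
  have := phi_ge (x t) Dt (Ut Dt); have := xL t Dt; rewrite mulrBr /c; lra.
(* [h] is only a.e. constant: where [u] leaves [U] nothing is known of [c]. *)
exists (fun t => if `[< U (u t) >] then - L else c t).
  apply: (integrable_ae_cst (k := - L) mD leb_D).
    exact: completed_lebesgue_measure_is_complete.
  move: u_in; apply: filterS; first exact: (ae_filter_ringOfSetsType leb).
  by move=> t Ut Dt; rewrite ifT//; apply/asboolP; exact: Ut.
move=> t Dt; case: asboolP => // Ut.
have := phi_ge (x t) Dt Ut; have := xL t Dt.
have := powR_ge0 `|u t| r; move: (`|u t| `^ r) => z z0.
rewrite mulrBr /c; have : 0 <= Cphi * z by rewrite mulr_ge0// ltW.
move: (Cphi * z) => w; lra.
Qed.

Lemma integrable_running_cost_control :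
  (\int[leb]_(t in D) (c t)%:E)%E \is a fin_num ->
  (\int[leb]_(t in D) (`|u t| `^ r)%:E < +oo)%E.
Proof.
move=> fc; have [L [L0 uL [h ih hc]]] := running_cost_lower_bound.
have mc := running_cost_measurable.
have neg := integral_funeneg_lty mD mc ih hc.
have ic := integrable_fin_num_integral mD mc neg fc.
apply: (ae_le_affine_integral_lty mD leb_D ic _ _ uL).
  exact: (measurable_powR_comp r measurable_lebesgue_norm).
by move=> t _; exact: powR_ge0.
Qed.

End running_cost.

Theorem lemma1 (R : realType) (T : R) (E : normedVectType R) (d : nat)
  (U : set E) (f : R -> E -> E) (g : R -> E -> 'End(E))
  (phi : R -> E -> E -> R) (psi : R -> E -> 'Hom('rV[R]_d, R^o))
  (eta : R -> 'rV[R]_d)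
  (kappa Cpsi alpha : R) (K : R -> R) (Cphi delta r : R)
  (xi : E) (Cs Ce beta gamma : R)
  (T_gt0 : 0 < T)
  (eta_cont : {within `[0, T], continuous eta})
  (eta_var : forall p : R, 2 < p -> (p_variation 0 T p eta < +oo)%E)
  (f_cont : {within [set z : R * E | z.1 \in `[0, T]],
     continuous (fun z => f z.1 z.2)})
  (g_cont : forall z0 : R * E, z0.1 \in `[0, T] ->
     op_norm (g z.1 z.2 - g z0.1 z0.2)
       @[z --> within [set z : R * E | z.1 \in `[0, T]] (nbhs z0)] --> 0)
  (kappa_gt : 2^-1 < kappa) (Cpsi_ge0 : 0 <= Cpsi) (alpha_ge0 : 0 <= alpha)
  (psi_holder : forall (rho s t : R) (x y : E), 0 <= rho ->
     s \in `[0, T] -> t \in `[0, T] -> `|x| <= rho -> `|y| <= rho ->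
     op_norm (psi t x - psi s y)
       <= K rho * (`|t - s| `^ kappa + `|x - y| `^ kappa))
  (K_le : forall rho : R, 0 <= rho -> K rho <= Cpsi * (1 + rho `^ alpha))
  (U_closed : closed U)
  (U_convex : convex_set U)
  (phi_cont : {within [set z : R * E * E | z.1.1 \in `[0, T] /\ U z.2],
     continuous (fun z => phi z.1.1 z.1.2 z.2)})
  (phi_convex : forall (t : R) (x : E), t \in `[0, T] -> convex_function U (phi t x))
  (Cphi_gt0 : 0 < Cphi) (delta_gt0 : 0 < delta) (r_gt1 : 1 < r)
  (phi_ge : forall (t : R) (x u : E), t \in `[0, T] -> U u ->
     Cphi * (`|u| `^ r - `|x| `^ delta) <= phi t x u)
  (Cs_ge0 : 0 <= Cs) (Ce_ge0 : 0 <= Ce)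
  (beta_ge0 : 0 <= beta) (gamma_ge0 : 0 <= gamma)
  (apriori : forall (u x : R -> E) (T1 : R),
     controls U T r u -> 0 < T1 -> T1 <= T -> solution f g T1 xi x u ->
     (Lr_norm r `[0%R, T1] x^`()%classic
        <= Cs%:E * (1 + Lr_norm r `[0%R, T] u `^ beta))%E /\
     (sup_norm `[0%R, T1] x
        <= Ce%:E * (1 + Lr_norm r `[0%R, T] u `^ gamma))%E)
  (exponents : gamma * (alpha + kappa - 2^-1) + beta / 2 < r)
  (gamma_delta : gamma * delta < r) :
  [/\ forall u, controls U T r u -> exists x, solution f g T xi x u,
      forall x u, feasible U f g T xi x u ->
        exists S : R, is_young_integral 0 T (fun t => psi t (x t)) eta S,
      forall x u, feasible U f g T xi x u ->
        let c : R -> R := fun t => phi t (x t) (u t) in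
        [/\ @measurable_fun _ _ (lebesgueType R) (measurableTypeR R)
              `[0, T] c,
            exists2 h : R -> R,
              completed_lebesgue_measure.-integrable `[0, T] (EFin \o h) &
              forall t : R, t \in `[0, T] -> h t <= c t,
            (\int[completed_lebesgue_measure]_(t in `[0%R, T])
               (EFin \o c)^\- t < +oo)%E &
            (-oo < deterministic_cost phi T x u)%E] &
      forall x u, admissible U f g phi psi eta T xi x u ->
        (Lr_norm r `[0%R, T] u < +oo)%E].
Proof.
pose leb := @completed_lebesgue_measure R.
have feasible_ac x u : feasible U f g T xi x u -> [/\ absolutely_continuous 0 T x,
    lebesgue_measurable `[0, T] u & takes_values_in_U U T u].
  by move=> [[mu [acx _ _]] uU].
split.
- move=> u cu; have [mu uU ur] := cu.
  have mnu := measurable_lebesgue_norm mu.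
  have mD := measurable_lebesgue_segment T.
  have leb_D := lebesgue_segment_lty T_gt0.
  have u_int : (\int[leb]_(t in `[0%R, T]) (`|u t|)%:E < +oo)%E.
    apply: (ge0_integral_le_powR mD leb_D (ltW r_gt1) mnu).
      by move=> t _; exact: normr_ge0.
    by move: ur; apply: lty_poweRy; rewrite invr_eq0 gt_eqF// (lt_trans ltr01).
  (* The bound involves the norm of [u] over all of [[0, T]], so one number serves the local
     solutions on every [[0, T1]]. *)
  pose b := (Ce%:E * (1 + Lr_norm r `[0%R, T] u `^ gamma))%E.
  have b_lt : (b < +oo)%E.
    apply: lte_mul_pinfty; rewrite ?lee_fin//.
    by apply: lte_add_pinfty; [exact: ltry|exact: poweR_lty].
  apply: (@global_solution_exists R T (fine b)) => //.
  move=> x T1 T1_gt0 T1_le sol t tT1.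
  have [_ xb] := apriori _ _ _ cu T1_gt0 T1_le sol.
  have xt : ((`|x t|)%:E <= b)%E.
    apply: le_trans xb; apply: ereal_sup_ubound; exists t => //.
  rewrite -lee_fin fineK// ge0_fin_numE//.
  exact: le_trans xt.
- move=> x u /feasible_ac[acx _ _].
  exact: (holder_young_integral T_gt0 eta_cont eta_var kappa_gt psi_holder acx).
- move=> x u /feasible_ac[acx mu uU] c.
  have mc := running_cost_measurable U_closed phi_cont mu uU acx.
  have [L [_ _ [h ih hc]]] :=
    running_cost_lower_bound T_gt0 Cphi_gt0 delta_gt0 phi_ge uU acx.
  have mD := measurable_lebesgue_segment T.
  have neg := integral_funeneg_lty mD mc ih hc.
  split; [exact: mc|by exists h|exact: neg|].
  exact: (integral_gt_ninfty neg).
move=> x u [/feasible_ac[acx mu uU] [S _ fin]].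
apply: poweR_lty.
apply: (integrable_running_cost_control T_gt0 U_closed phi_cont Cphi_gt0 delta_gt0
  phi_ge mu uU acx).
move: fin; rewrite fin_numD => /andP[+ _]; apply.
Qed.
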